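(* Let $\theta\ge2$ be an integer, let $0\le k\le n$, where $k=k(n)$ may depend on $n$, and let $C_{n,k}^{(\theta)}$ be the containment level of the vertex labeled $k$ in a hyperrecursive tree with hyperedge size $\theta$ at age $n$. As $n\to\infty$: (i) for $k$ fixed, $$\frac{C_{n,k}^{(\theta)}-(\theta-1)\ln(n)}{\sqrt{\ln(n)}}\ \xrightarrow{\ \mathcal D\ }\ \mathcal N(0,\theta-1);$$ (ii) for $k\to\infty$ and $k=o(n)$, $$\frac{C_{n,k}^{(\theta)}-(\theta-1)\ln\big(\frac nk\big)}{\sqrt{\ln\big(\frac nk\big)}}\ \xrightarrow{\ \mathcal D\ }\ \mathcal N(0,\theta-1);$$ (iii) for $k\sim\alpha n$ with $0<\alpha<1$, $$C_{n,k}^{(\theta)}\ \xrightarrow{\ \mathcal D\ }\ 1+\mathrm{Poi}\Big((\theta-1)\ln\Big(\frac1\alpha\Big)\Big);$$ (iv) for $k=n-o(n)$, $$C_{n,k}^{(\theta)}\ \xrightarrow{\ \mathcal P\ }\ 1.$$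
   Context: Hyperrecursive tree with hyperedge size $\theta$ (an integer $\theta\ge2$): at time $0$ there are $\theta$ originating vertices, all labeled $0$, which together form the first hyperedge. At each time $n\ge1$ a new vertex labeled $n$ is added; a subset of size $\theta-1$ of the $n-1+\theta$ existing vertices is chosen uniformly at random among all subsets of that size (independently of the past), and the new vertex together with the chosen vertices forms a new hyperedge. The structure at time $n$ (right after insertion of vertex $n$) is said to have age $n$. The containment level $C_{n,k}^{(\theta)}$ of vertex $k$ at time $n\ge k$ is the number of hyperedges containing vertex $k$ at time $n$; for $k=0$ one tracks a fixed chosen representative among the $\theta$ originators. $\xrightarrow{\mathcal D}$ and $\xrightarrow{\mathcal P}$ denote convergence in distribution and in probability; $\mathcal N(0,\sigma^2)$ is the centered normal law with variance $\sigma^2$; $\mathrm{Poi}(\lambda)$ is a Poisson random variable with mean $\lambda$. *)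

(* Defs.v *)
From HB Require Import structures.
From mathcomp Require Import all_boot all_order all_algebra finmap.
From mathcomp Require Import all_classical all_reals all_analysis.
From mathcomp Require Import measurable_realfun.

Set Implicit Arguments.
Unset Strict Implicit.
Unset Printing Implicit Defensive.

Import Order.TTheory GRing.Theory Num.Theory.
Import numFieldNormedType.Exports.

Local Open Scope classical_set_scope.
Local Open Scope ring_scope.

(** Vertices are natural numbers: the originators (all labeled 0) are
    0, ..., theta - 1, and the vertex labeled m.+1, inserted at time m.+1, is
    m + theta.  The vertices existing just before time m.+1 are therefore the
    elements of 'I_(m + theta), and [c m] is the set chosen at time m.+1. *)
Section hypertree.
Variable theta : nat.

Definition choices := forall m : nat, {set 'I_(m + theta)}.

Definition hyperedge (c : choices) (n : nat) : {fset nat} :=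
  if n is m.+1 then ((m + theta)%N |` [fset val i | i in c m])%fset
  else [fset v in iota 0 theta]%fset.

Definition hyperedges (c : choices) (n : nat) : {fset {fset nat}} :=
  [fset hyperedge c j | j in iota 0 n.+1]%fset.

(** [r] is the chosen representative of the originators. *)
Definition vertex (r : 'I_theta) (k : nat) : nat :=
  if k is m.+1 then (m + theta)%N else r.

Definition containment (c : choices) (r : 'I_theta) (n k : nat) : nat :=
  #|` [fset e in hyperedges c n | vertex r k \in e]%fset|.

Lemma eq_containment (c c' : choices) (r : 'I_theta) (n k : nat) :
  (forall j, (j < n)%N -> c j = c' j) ->
  containment c r n k = containment c' r n k.
Proof.
move=> cc'; rewrite /containment; suff -> : hyperedges c n = hyperedges c' n by [].
have E j : (j <= n)%N -> hyperedge c j = hyperedge c' j.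
  by case: j => //= j jn; rewrite cc'.
have En j : j \in iota 0 n.+1 -> hyperedge c j = hyperedge c' j.
  by rewrite mem_iota add0n ltnS => /E.
by apply/fsetP => e; apply/imfsetP/imfsetP => -[j /= jn ->]; exists j;
  rewrite // En.
Qed.

End hypertree.

(** The last axiom says that, conditionally on any past, the set chosen at time
    m.+1 is uniform among the (theta - 1)-subsets of the existing vertices. *)
Record hyperrecursive_tree d (T : measurableType d) (R : realType)
    (P : probability T R) (theta : nat) := HyperrecursiveTree {
  chosen : forall m : nat, T -> {set 'I_(m + theta)} ;
  measurable_chosen : forall m (A : {set 'I_(m + theta)}),
    measurable (chosen m @^-1` [set A]) ;
  chosen_uniform : forall m (A : {set 'I_(m + theta)}) (past : choices theta),
    P ([set w | chosen m w = A] `&`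
       [set w | forall j, (j < m)%N -> chosen j w = past j]) =
    ((if #|A| == theta.-1 then 'C(m + theta, theta.-1)%:R^-1 else 0)%:E *
     P [set w | forall j, (j < m)%N -> chosen j w = past j])%E }.

Section containment_level.
Context d (T : measurableType d) (R : realType) (P : probability T R)
  (theta : nat).
Variables (H : hyperrecursive_tree P theta) (r : 'I_theta) (n k : nat).

Definition containment_level (w : T) : nat :=
  containment (fun m => chosen H m w) r n k.

Let measurable_history (c : {dffun forall j : 'I_n, {set 'I_(j + theta)}}) :
  measurable [set w | forall j : 'I_n, chosen H j w = c j].
Proof.
rewrite (_ : mkset _ = \bigcap_(j in [set: 'I_n])
    (chosen H j @^-1` [set c j])); last first.
  by apply/seteqP; split=> [w h j _|w h j]; [exact: h | exact: (h j I)].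
apply: fin_bigcap_measurable => // j _; exact: measurable_chosen.
Qed.

Lemma measurable_containment_level : measurable_fun setT containment_level.
Proof.
move=> _ Y _; rewrite setTI.
pose history w : {dffun forall j : 'I_n, {set 'I_(j + theta)}} :=
  [ffun j : 'I_n => chosen H j w].
rewrite (_ : containment_level @^-1` Y = \bigcup_(c in history @`
    (containment_level @^-1` Y)) [set w | forall j : 'I_n, chosen H j w = c j]).
  apply: fin_bigcup_measurable => [|c _]; last exact: measurable_history.
  exact: finite_finset.
apply/seteqP; split=> [w Yw|w [_ [w' Yw' <-]] h] /=.
  by exists (history w) => [|j /=]; [exists w | rewrite ffunE].
suff -> : containment_level w = containment_level w' by [].
apply: eq_containment => j jn; have := h (Ordinal jn); by rewrite ffunE.
Qed.

HB.instance Definition _ := @isMeasurableFun.Build _ _ _ _ containment_level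
  measurable_containment_level.

End containment_level.

Section real_random_variables.
Context d (T : measurableType d) (R : realType).

Definition natr_fun (X : T -> nat) (w : T) : R := (X w)%:R.

Lemma measurable_natr_fun (X : {mfun T >-> nat}) :
  measurable_fun setT (natr_fun X).
Proof. exact: (@measurableT_comp _ _ _ _ _ _ (fun m : nat => m%:R : R)). Qed.

HB.instance Definition _ (X : {mfun T >-> nat}) :=
  @isMeasurableFun.Build _ _ _ _ (natr_fun X) (measurable_natr_fun X).

Definition normalized (X : T -> R) (a b : R) (w : T) : R :=
  (X w - a) / Num.sqrt b.

Lemma measurable_normalized (X : {mfun T >-> R}) (a b : R) :
  measurable_fun setT (normalized X a b).
Proof. by apply: measurable_funM => //; exact: measurable_funB. Qed.

HB.instance Definition _ (X : {mfun T >-> R}) (a b : R) :=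
  @isMeasurableFun.Build _ _ _ _ (normalized X a b)
    (measurable_normalized X a b).

End real_random_variables.

Section one_plus_poisson.
Variable R : realType.

Let one_plus (j : nat) : measurableTypeR R := 1 + j%:R.

Let measurable_one_plus : measurable_fun setT one_plus.
Proof. by []. Qed.

HB.instance Definition _ := @isMeasurableFun.Build _ _ _ _ one_plus
  measurable_one_plus.

(** The law of 1 + N with N Poisson of mean [rate], as a law on the reals (the
    second argument of [poisson_prob] is unused by the library). *)
Definition one_plus_poisson (rate : R) : probability (measurableTypeR R) R :=
  distribution (poisson_prob rate 0%N) one_plus.

End one_plus_poisson.

(** [normal_prob] takes the standard deviation as its second argument. *)
Definition centered_normal (R : realType) (v : R) : probability (measurableTypeR R) R :=
  normal_prob 0 (Num.sqrt v).

Section convergence.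
Context d (T : measurableType d) (R : realType) (P : probability T R).

Definition cvg_in_distribution (X : nat -> {RV P >-> R})
    (mu : probability (measurableTypeR R) R) : Prop :=
  let F (x : R) := mu [set` `]-oo, x]] in
  forall x : R, {for x, continuous F} -> cdf (X n) x @[n --> \oo] --> F x.

Definition cvg_in_probability (X : nat -> {RV P >-> R}) (Y : {RV P >-> R}) :
    Prop :=
  forall e : R, 0 < e ->
    P [set w | e < `|X n w - Y w|] @[n --> \oo] --> 0%E.

End convergence.

Arguments cvg_in_distribution {d T R} P X mu.
Arguments cvg_in_probability {d T R} P X Y.

(* Main.v *)
Require Import Defs.
From HB Require Import structures.
From mathcomp Require Import all_boot all_order all_algebra finmap.
From mathcomp Require Import all_classical all_reals all_analysis.
From mathcomp Require Import measurable_realfun.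
From mathcomp Require Import ring lra.
Import Order.TTheory GRing.Theory Num.Theory.
Import numFieldNormedType.Exports.
Local Open Scope classical_set_scope.
Local Open Scope ring_scope.

(** The containment level of vertex k at age n is 1 + S, where S is a sum of
    independent Bernoulli variables with parameters p_m = (theta - 1)/(m + theta),
    k <= m < n; by comparison with the logarithm, sum p_m is close to
    (theta - 1) ln (n/k), while sum p_m^2 stays bounded and is O(1/k).

    Both limit laws come from a Lindeberg exchange: if a function F (rho, j)
    almost satisfies (1 - p) F (rho, j) + p F (rho, j + 1) = F (rho + p, j), then
    E F (0, S) is close to F (sum p_m, 0).  With F (rho, j) the probability that
    j plus a Poisson variable of mean rho stays below a threshold, the error of
    one exchange is 2 p^2, whence (iii).  With
    F (rho, y) = Phi ((A - y - rho)/sqrt (B + rho)), an explicit solution of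
    F_rho = F_y + F_yy / 2, the error is O(p^2/B + p/B^(3/2)).  Taking B a small
    multiple of ln (n/k), the value E F (0, S) is the distribution function of S
    smoothed by a narrow Gaussian; comparing it with a genuine indicator gives (i)
    and (ii).  Finally (iv) follows from E S = sum p_m --> 0. *)

(** * Taylor bounds and the Gaussian heat kernel *)

Lemma mean_value_bound01 (R : realType) (g g' : R -> R) (K : R) :
  (forall t : R, 0 <= t <= 1 -> is_derive t 1 g (g' t)) ->
  (forall t : R, 0 <= t <= 1 -> `|g' t| <= K) ->
  forall t : R, 0 <= t <= 1 -> `|g t - g 0| <= K.
Proof.
move=> dg bg t /andP[t0 t1].
have [c|c|c cin ->] := @MVT_segment R g g' 0 t t0.
- by rewrite in_itv/= => /andP[c0 ct]; apply: dg; lra.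
- apply: derivable_within_continuous => u; rewrite in_itv/= => /andP[u0 ut].
  by have [] : is_derive u 1 g (g' u) by apply: dg; lra.
move: cin; rewrite in_itv/= => /andP[c0 ct].
have K0 : 0 <= K by apply: le_trans (bg 0 _); rewrite ?lexx ?ler01.
rewrite subr0 normrM (ger0_norm t0) -[leRHS]mulr1.
by apply: ler_pM => //; apply: bg; lra.
Qed.

(** The mean value bound is applied twice along the segment, to the derivative and then to the
    function minus its tangent; this gives [K] rather than [K / 2], which suffices. The hypotheses
    concern the segment alone because the heat kernel involves [sqrt (B + rho)], smooth only for
    [B + rho > 0]. *)
Lemma taylor2_bound (R : realType) (f f1 f2 : R -> R) (x h K : R) :
  (forall t : R, 0 <= t <= 1 -> is_derive (x + t * h) 1 f (f1 (x + t * h))) ->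
  (forall t : R, 0 <= t <= 1 -> is_derive (x + t * h) 1 f1 (f2 (x + t * h))) ->
  (forall t : R, 0 <= t <= 1 -> `|f2 (x + t * h)| <= K) ->
  `|f (x + h) - f x - h * f1 x| <= K * h ^+ 2.
Proof.
move=> df df1 b2.
pose g t := f (x + t * h); pose g1 t := h * f1 (x + t * h).
have daff (t : R) : is_derive t 1 (fun t : R => x + t * h) h.
  by apply: is_derive_eq; rewrite /GRing.scale/=; ring.
have dg (t : R) : 0 <= t <= 1 -> is_derive t 1 g (g1 t).
  move=> ht; rewrite /g /g1 mulrC.
  by apply: is_derive1_comp => //; exact: df.
have dg1 (t : R) : 0 <= t <= 1 -> is_derive t 1 g1 (h ^+ 2 * f2 (x + t * h)).
  move=> ht; have ? := df1 _ ht.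
  have -> : h ^+ 2 * f2 (x + t * h) = h * (f2 (x + t * h) * h) by ring.
  by apply: is_deriveZ; exact: is_derive1_comp.
have B1 (t : R) : 0 <= t <= 1 -> `|g1 t - g1 0| <= K * h ^+ 2.
  apply: (mean_value_bound01 _ _ _ _ dg1) => u hu.
  rewrite normrM mulrC (ger0_norm (sqr_ge0 h)).
  by apply: ler_wpM2r; [exact: sqr_ge0|exact: b2].
have dk (t : R) : 0 <= t <= 1 -> is_derive t 1 (fun t => g t - t * g1 0) (g1 t - g1 0).
  move=> ht; have ? := dg _ ht.
  by apply: is_derive_eq; rewrite scaler0 add0r /GRing.scale/= mulr1.
have := mean_value_bound01 _ _ _ _ dk B1 1.
rewrite ler01 lexx => /(_ isT); rewrite /g /g1 !mul0r !mul1r !addr0 subr0.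
by congr (`|_| <= _); ring.
Qed.

(** Once the quadratic term is subtracted, the second derivative along the segment is
    [h ^+ 2 * (f2 (x + t * h) - f2 x)], of size [K * |h| ^+ 3] by the mean value theorem, and the
    second-order bound applies on [[0, 1]]. *)
Lemma taylor3_bound (R : realType) (f f1 f2 f3 : R -> R) (x h K : R) :
  (forall y : R, is_derive y 1 f (f1 y)) ->
  (forall y : R, is_derive y 1 f1 (f2 y)) ->
  (forall y : R, is_derive y 1 f2 (f3 y)) ->
  (forall y : R, `|f3 y| <= K) ->
  `|f (x + h) - f x - h * f1 x - h ^+ 2 / 2 * f2 x| <= K * `|h| ^+ 3.
Proof.
move=> df df1 df2 b3.
have daff (t : R) : is_derive t 1 (fun t : R => x + t * h) h.
  by apply: is_derive_eq; rewrite /GRing.scale/=; ring.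
pose g t := f (x + t * h) - h ^+ 2 / 2 * f2 x * t ^+ 2.
pose g1 t := h * f1 (x + t * h) - h ^+ 2 * f2 x * t.
have dg (t : R) : is_derive t 1 g (g1 t).
  have ? : is_derive t 1 (fun t => f (x + t * h)) (h * f1 (x + t * h)).
    by rewrite mulrC; exact: is_derive1_comp.
  by apply: is_derive_eq; rewrite /g1 /GRing.scale/=; field.
have dg1 (t : R) : is_derive t 1 g1 (h ^+ 2 * (f2 (x + t * h) - f2 x)).
  have ? : is_derive t 1 (fun t => f1 (x + t * h)) (h * f2 (x + t * h)).
    by rewrite mulrC; exact: is_derive1_comp.
  by apply: is_derive_eq; rewrite /GRing.scale/=; ring.
have B2 (t : R) : 0 <= t <= 1 -> `|f2 (x + t * h) - f2 x| <= K * `|h|.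
  move=> ht; have dk (u : R) : 0 <= u <= 1 ->
      is_derive u 1 (fun u => f2 (x + u * h)) (h * f3 (x + u * h)).
    by move=> _; rewrite mulrC; exact: is_derive1_comp.
  have := mean_value_bound01 _ _ _ (K * `|h|) dk _ _ ht.
  rewrite mul0r addr0; apply=> u _.
  by rewrite normrM mulrC ler_wpM2r.
have := @taylor2_bound R g g1 (fun t => h ^+ 2 * (f2 (x + t * h) - f2 x)) 0 1
  (K * `|h| ^+ 3) (fun t _ => dg _) (fun t _ => dg1 _).
rewrite /g /g1 !add0r !mul0r !mulr0 expr0n/= !mulr0 !subr0 expr1n !mulr1 !mul1r.
rewrite addr0; move=> H; apply: le_trans (H _); last first.
  move=> t ht; rewrite add0r mulr1 normrM normrX.
  rewrite (_ : K * _ = `|h| ^+ 2 * (K * `|h|)); last by ring.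
  by rewrite ler_wpM2l ?exprn_ge0// B2.
by rewrite le_eqVlt; apply/orP; left; apply/eqP; congr (`|_|); field.
Qed.

(** From [exp u >= 1 + u ^ 2 / 2] at [u = z ^ 2 / 2] one gets [8 * exp (z ^ 2 / 2) >= 8 + z ^ 4],
    while [|z| ^ k <= 1 + z ^ 4] for [k <= 4]. *)
Lemma normrX_expR_bound (R : realType) (z : R) (k : nat) : (k <= 4)%N ->
  `|z| ^+ k * expR (- (z ^+ 2 / 2)) <= 8.
Proof.
move=> k4; rewrite expRN ler_pdivrMr ?expR_gt0//.
have : 0 <= z ^+ 2 / 2 by rewrite divr_ge0 ?sqr_ge0.
move=> /(expR_ge1Dxn 1); rewrite /= (_ : 2`!%:R = 2 :> R)// => e1.
apply: (@le_trans _ _ (1 + z ^+ 4)); last first.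
  have -> : z ^+ 4 = 8 * ((z ^+ 2 / 2) ^+ 2 / 2) by field.
  lra.
have z4 : `|z| ^+ 4 = z ^+ 4.
  by rewrite -normrX ger0_norm// (_ : z ^+ 4 = (z ^+ 2) ^+ 2) ?sqr_ge0//; ring.
have [z1|/ltW z1] := leP `|z| 1.
  apply: (@le_trans _ _ 1); first exact: exprn_ile1.
  by rewrite -z4 lerDl exprn_ge0.
rewrite -z4; apply: (@le_trans _ _ (`|z| ^+ 4)); last by rewrite lerDr.
exact: ler_weXn2l.
Qed.

Lemma is_derive_gauss (R : realType) (c z : R) :
  is_derive z 1 (fun z => c * expR (- (z ^+ 2 / 2)))
    (- (z * (c * expR (- (z ^+ 2 / 2))))).
Proof.
have d1 : is_derive z 1 (fun z : R => - (z ^+ 2 / 2)) (- z).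
  by apply: is_derive_eq; rewrite /GRing.scale/=; field.
have d2 : is_derive z 1 (fun z : R => expR (- (z ^+ 2 / 2)))
    (expR (- (z ^+ 2 / 2)) * - z).
  exact: is_derive1_comp.
by apply: is_derive_eq; rewrite /GRing.scale/=; ring.
Qed.

(** The third derivative of [Phi] is [(y ^ 2 - 1) * c * exp (- y ^ 2 / 2)], at most [16 * c] by the
    bounds for the exponents 0 and 2. [Phi] stays an abstract primitive of a Gaussian until
    [normal_cdf_gauss] supplies the normal distribution function. *)
Lemma increment_gauss_bound (R : realType) (Phi : R -> R) (c z h : R) : 0 <= c ->
  (forall y : R, is_derive y 1 Phi (c * expR (- (y ^+ 2 / 2)))) ->
  `|Phi (z + h) - Phi z - h * (c * expR (- (z ^+ 2 / 2)))
     + h ^+ 2 / 2 * (z * (c * expR (- (z ^+ 2 / 2))))| <= 16 * c * `|h| ^+ 3.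
Proof.
move=> c0 dPhi.
have -> : Phi (z + h) - Phi z - h * (c * expR (- (z ^+ 2 / 2)))
   + h ^+ 2 / 2 * (z * (c * expR (- (z ^+ 2 / 2)))) =
   Phi (z + h) - Phi z - h * (c * expR (- (z ^+ 2 / 2)))
   - h ^+ 2 / 2 * (- (z * (c * expR (- (z ^+ 2 / 2))))) by ring.
apply: (@taylor3_bound R Phi (fun y => c * expR (- (y ^+ 2 / 2)))
  (fun y => - (y * (c * expR (- (y ^+ 2 / 2)))))
  (fun y => (y ^+ 2 - 1) * (c * expR (- (y ^+ 2 / 2))))) => // [y|y|y].
- exact: is_derive_gauss.
- have ? := is_derive_gauss _ c y.
  by apply: is_derive_eq; rewrite /GRing.scale/=; ring.
- have e0 := @normrX_expR_bound R y 0 isT.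
  have e2 := @normrX_expR_bound R y 2 isT.
  rewrite mulrCA normrM (ger0_norm c0) [leRHS]mulrC ler_wpM2l//.
  rewrite normrM (ger0_norm (expR_ge0 _)) (@le_trans _ _
    ((`|y| ^+ 2 + 1) * expR (- (y ^+ 2 / 2))))//.
    rewrite ler_wpM2r ?expR_ge0// (le_trans (ler_normB _ _))//.
    by rewrite normrX normr1.
  by rewrite mulrDl; move: e0; rewrite expr0 !mul1r; lra.
Qed.

Lemma is_derive_inv_sqrt (R : realType) (B rho : R) : 0 < B + rho ->
  is_derive rho 1 (fun rho => (Num.sqrt (B + rho))^-1)
    (- ((Num.sqrt (B + rho))^-1 ^+ 3 / 2)).
Proof.
move=> s0.
have q0 : Num.sqrt (B + rho) != 0 by rewrite gt_eqF// sqrtr_gt0.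
have d1 : is_derive rho 1 (fun rho : R => B + rho) 1.
  by apply: is_derive_eq; ring.
have ? := is_derive1_sqrt s0.
have d2 : is_derive rho 1 (fun rho : R => Num.sqrt (B + rho))
    ((2 * Num.sqrt (B + rho))^-1 * 1).
  exact: is_derive1_comp.
have d3 := @is_deriveV R (fun rho : R => Num.sqrt (B + rho)) _ _ _ q0 d2.
by apply: is_derive_eq; rewrite /GRing.scale/=; field.
Qed.

Lemma is_derive_zscore (R : realType) (D B rho : R) : 0 < B + rho ->
  is_derive rho 1 (fun rho => (D - rho) * (Num.sqrt (B + rho))^-1)
    (- (Num.sqrt (B + rho))^-1
     - (D - rho) * (Num.sqrt (B + rho))^-1 ^+ 3 / 2).
Proof.
move=> s0; have ? := is_derive_inv_sqrt _ _ _ s0.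
have d4 : is_derive rho 1 (fun rho : R => D - rho) (-1).
  by apply: is_derive_eq; ring.
by apply: is_derive_eq; rewrite /GRing.scale/=; ring.
Qed.

Lemma is_derive_zscore2 (R : realType) (D B rho : R) : 0 < B + rho ->
  is_derive rho 1 (fun rho => - (Num.sqrt (B + rho))^-1
     - (D - rho) * (Num.sqrt (B + rho))^-1 ^+ 3 / 2)
    ((Num.sqrt (B + rho))^-1 ^+ 3
     + 3 / 4 * (D - rho) * (Num.sqrt (B + rho))^-1 ^+ 5).
Proof.
move=> s0; have dr := is_derive_inv_sqrt _ _ _ s0.
have d4 : is_derive rho 1 (fun rho : R => D - rho) (-1).
  by apply: is_derive_eq; ring.
apply: is_derive_eq; rewrite /GRing.scale/=.
by move: (Num.sqrt _)^-1 => q; field.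
Qed.

(** Expansion in time of the heat solution. Since the derivative of [z] is [- (r + z * r ^ 2 / 2)],
    the linear term is the one that a unit step in space, that is [z] replaced by [z - r], produces
    up to second order. The second derivative carries a factor [r ^ 2 <= 1 / B] and a cubic
    polynomial in [|z|] tamed by the Gaussian. *)
Lemma shift_gauss_bound (R : realType) (Phi : R -> R) (c D B rho p : R)
    (r := (Num.sqrt (B + rho))^-1) (z := (D - rho) * r)
    (phi := c * expR (- (z ^+ 2 / 2))) :
  0 <= c -> (forall y : R, is_derive y 1 Phi (c * expR (- (y ^+ 2 / 2)))) ->
  1 <= B -> 0 <= rho -> 0 <= p ->
  `|Phi ((D - (rho + p)) / Num.sqrt (B + (rho + p))) - Phi z
    + p * (r * phi + r ^+ 2 / 2 * (z * phi))| <= 40 * c / B * p ^+ 2.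
Proof.
move=> c0 dPhi B1 rho0 p0.
pose rr t := (Num.sqrt (B + t))^-1.
pose zz t := (D - t) * rr t.
pose z1 t := - rr t - (D - t) * rr t ^+ 3 / 2.
pose z2 t := rr t ^+ 3 + 3 / 4 * (D - t) * rr t ^+ 5.
pose ph t := c * expR (- (zz t ^+ 2 / 2)).
have pos t : 0 <= t -> 0 < B + t by lra.
have dz (t : R) : 0 <= t -> is_derive t 1 zz (z1 t).
  by move=> /pos; exact: is_derive_zscore.
have dz1 (t : R) : 0 <= t -> is_derive t 1 z1 (z2 t).
  by move=> /pos; exact: is_derive_zscore2.
pose f1 t := ph t * z1 t.
pose f2 t := ph t * z2 t - zz t * ph t * z1 t ^+ 2.
have df (t : R) : 0 <= t -> is_derive t 1 (Phi \o zz) (f1 t).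
  by move=> /dz ?; exact: is_derive1_comp.
have df1 (t : R) : 0 <= t -> is_derive t 1 f1 (f2 t).
  move=> t0; have ? := dz _ t0; have ? := dz1 _ t0.
  have ? : is_derive t 1 ph (- (zz t * ph t) * z1 t).
    have ? := is_derive_gauss _ c (zz t).
    exact: (@is_derive1_comp R (fun z => c * expR (- (z ^+ 2 / 2))) zz).
  by apply: is_derive_eq; rewrite /f2 /GRing.scale/=; ring.
have -> : Phi ((D - (rho + p)) / Num.sqrt (B + (rho + p))) - Phi z
    + p * (r * phi + r ^+ 2 / 2 * (z * phi)) =
    (Phi \o zz) (rho + p) - (Phi \o zz) rho - p * f1 rho.
  by rewrite /= /f1 /zz /rr -/r -/z /ph /zz /z1 /rr -/r -/z -/phi /z; ring.
have seg u : 0 <= u <= 1 -> 0 <= rho + u * p.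
  by case/andP=> u0 _; rewrite addr_ge0// mulr_ge0.
apply: (@taylor2_bound R (Phi \o zz) f1 f2 rho p (40 * c / B)) => u /seg.
- exact: df.
- exact: df1.
move: (rho + u * p) => t t0.
have r0 : 0 <= rr t by rewrite invr_ge0 sqrtr_ge0.
have r2 : rr t ^+ 2 = (B + t)^-1 by rewrite exprVn sqr_sqrtr// ltW// pos.
have r2B : rr t ^+ 2 <= B^-1 by rewrite r2 lef_pV2 ?posrE ?pos//; lra.
have r1 : rr t <= 1.
  rewrite -(@ler_pXn2r _ 2) ?nnegrE// expr1n (le_trans r2B)// invf_le1; lra.
have e0 := @normrX_expR_bound R (zz t) 0 isT.
have e1 := @normrX_expR_bound R (zz t) 1 isT.
have e2 := @normrX_expR_bound R (zz t) 2 isT.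
have e3 := @normrX_expR_bound R (zz t) 3 isT.
set g := expR _ in e0 e1 e2 e3.
have g0 : 0 <= g by exact: expR_ge0.
(* In terms of [zz t] and [rr t], the factor [rr t ^+ 2] comes out of [f2 t], and the rest is
   controlled by [rr t <= 1]. *)
have z1E : z1 t = - (rr t * (1 + zz t * rr t / 2)) by rewrite /z1 /zz; ring.
have z2E : z2 t = rr t ^+ 2 * (rr t * (1 + 3 / 4 * (zz t * rr t))).
  by rewrite /z2 /zz; ring.
have zr : `|zz t * rr t| <= `|zz t|.
  by rewrite normrM (ger0_norm r0) ler_piMr.
have -> : f2 t =
   c * rr t ^+ 2 * (g * (rr t * (1 + 3 / 4 * (zz t * rr t))
     - zz t * (1 + zz t * rr t / 2) ^+ 2)).
  by rewrite /f2 z1E z2E /ph -/g; ring.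
have -> : 40 * c / B = c * (B^-1 * 40) by ring.
rewrite -mulrA normrM (ger0_norm c0) ler_wpM2l// normrM (ger0_norm (sqr_ge0 _)).
apply: ler_pM => //; first exact: sqr_ge0.
rewrite normrM (ger0_norm g0).
set Z := `|zz t| in e0 e1 e2 e3 zr *.
apply: (@le_trans _ _ (g * (1 + 3 / 4 * Z + Z * (1 + Z / 2) ^+ 2))).
  rewrite ler_wpM2l// (le_trans (ler_normB _ _))//.
  have hZ : 0 <= Z by exact: normr_ge0.
  apply: lerD.
    rewrite normrM (ger0_norm r0) -[leRHS]mul1r ler_pM//.
    rewrite (le_trans (ler_normD _ _))// normr1 lerD2l normrM.
    rewrite (@ger0_norm _ (3 / 4)); last by lra.
    by rewrite ler_wpM2l//; lra.
  rewrite normrM -/Z ler_wpM2l// normrX lerXn2r ?nnegrE//.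
    by rewrite addr_ge0// divr_ge0.
  rewrite (le_trans (ler_normD _ _))// normr1 lerD2l normrM.
  by rewrite (@ger0_norm _ 2^-1) ?ler_wpM2r ?invr_ge0.
(* Each [Z ^+ k * g] is at most 8, so the sum is at most [8 * (1 + 3/4 + 1 + 1 + 1/4) = 32]. *)
rewrite (_ : g * _ = Z ^+ 0 * g + 3 / 4 * (Z ^+ 1 * g) + Z ^+ 1 * g
   + Z ^+ 2 * g + Z ^+ 3 * g / 4); last by rewrite expr0 expr1; field.
lra.
Qed.

(* [F (rho, y) = Phi ((A - y - rho) / sqrt (B + rho))] solves the heat equation
   [F_rho = F_y + F_yy / 2], so the two Taylor expansions cancel up to second
   order. *)
Lemma heat_step (R : realType) (Phi : R -> R) (c A B rho p y : R)
    (F := fun rho y => Phi ((A - y - rho) / Num.sqrt (B + rho))) :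
  0 <= c -> (forall y : R, is_derive y 1 Phi (c * expR (- (y ^+ 2 / 2)))) ->
  1 <= B -> 0 <= rho -> 0 <= p ->
  `|(1 - p) * F rho y + p * F rho (y + 1) - F (rho + p) y| <=
    40 * c / B * p ^+ 2 + 16 * c * (Num.sqrt B)^-1 ^+ 3 * p.
Proof.
move=> c0 dPhi B1 rho0 p0.
have := shift_gauss_bound R Phi c (A - y) B rho p c0 dPhi B1 rho0 p0.
set r := (Num.sqrt (B + rho))^-1; set z := _ * r; set phi := c * expR _ => /= h1.
have := increment_gauss_bound R Phi c z (- r) c0 dPhi.
rewrite -/phi => h2.
have r0 : 0 <= r by rewrite invr_ge0 sqrtr_ge0.
rewrite normrN (ger0_norm r0) in h2.
have rB : r <= (Num.sqrt B)^-1.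
  by rewrite lef_pV2 ?posrE ?sqrtr_gt0 ?ler_wsqrtr//; lra.
have E1 : F rho (y + 1) = Phi (z - r).
  by rewrite /F -/r; congr Phi; rewrite /z; ring.
have E0 : F rho y = Phi z by [].
rewrite E0 E1 /F.
set X := Phi (_ / _) in h1 *.
rewrite (_ : _ - X = p * (Phi (z - r) - Phi z - - r * phi
   + (- r) ^+ 2 / 2 * (z * phi)) -
   (X - Phi z + p * (r * phi + r ^+ 2 / 2 * (z * phi)))); last by ring.
rewrite (le_trans (ler_normB _ _))// addrC lerD// normrM (ger0_norm p0) mulrC.
rewrite ler_wpM2r// (le_trans h2)// ler_wpM2l ?mulr_ge0//.
by rewrite lerXn2r ?nnegrE ?invr_ge0 ?sqrtr_ge0.
Qed.

(** * Sums of Bernoulli variables *)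

(** The mean of [F S] for [S] a sum of [n] independent Bernoulli variables of
    parameters [p 0], ..., [p n.-1]. *)
Fixpoint bernoulli_mean {R : realType} (p : nat -> R) (n : nat) (F : nat -> R) : R :=
  if n is m.+1 then
    bernoulli_mean p m (fun j => (1 - p m) * F j + p m * F j.+1)
  else F 0%N.

Lemma eq_bernoulli_mean (R : realType) (p : nat -> R) n (F G : nat -> R) :
  (forall j, F j = G j) -> bernoulli_mean p n F = bernoulli_mean p n G.
Proof. by move=> FG; congr bernoulli_mean; apply/funext. Qed.

Lemma bernoulli_mean_lin (R : realType) (p : nat -> R) n (a b : R) (F G : nat -> R) :
  bernoulli_mean p n (fun j => a * F j + b * G j) =
  a * bernoulli_mean p n F + b * bernoulli_mean p n G.
Proof.
elim: n F G => //= n IHn F G; rewrite -IHn.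
by apply: eq_bernoulli_mean => j; ring.
Qed.

Lemma bernoulli_mean_cst (R : realType) (p : nat -> R) n (a : R) :
  bernoulli_mean p n (fun=> a) = a.
Proof.
elim: n => //= n IHn; rewrite -[RHS]IHn; apply: eq_bernoulli_mean => j; ring.
Qed.

Lemma bernoulli_mean_le (R : realType) (p : nat -> R) n (F G : nat -> R) :
  (forall i, 0 <= p i <= 1) -> (forall j, F j <= G j) ->
  bernoulli_mean p n F <= bernoulli_mean p n G.
Proof.
move=> p01; elim: n F G => //= n IHn F G FG; apply: IHn => j.
by have /andP[? ?] := p01 n; rewrite lerD// ler_wpM2l// subr_ge0.
Qed.

Lemma bernoulli_mean_leD (R : realType) (p : nat -> R) n (F G : nat -> R) (e : R) :
  (forall i, 0 <= p i <= 1) -> (forall j, F j <= G j + e) ->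
  bernoulli_mean p n F <= bernoulli_mean p n G + e.
Proof.
move=> p01 FG.
have -> : bernoulli_mean p n G + e = bernoulli_mean p n (fun j => 1 * G j + 1 * e).
  by rewrite bernoulli_mean_lin bernoulli_mean_cst !mul1r.
by apply: bernoulli_mean_le => // j; rewrite !mul1r.
Qed.

(* One trial at a time is exchanged for time [p i] of the evolution [F]. *)
Lemma bernoulli_mean_telescope (R : realType) (p e : nat -> R) n
    (F : R -> nat -> R) :
  (forall i, 0 <= p i <= 1) ->
  (forall i rho j, 0 <= rho ->
    `|(1 - p i) * F rho j + p i * F rho j.+1 - F (rho + p i) j| <= e i) ->
  forall rho, 0 <= rho ->
  `|bernoulli_mean p n (F rho) - F (rho + \sum_(i < n) p i) 0%N|
     <= \sum_(i < n) e i.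
Proof.
move=> p01 step; elim: n => [|n IHn] rho rho0 /=.
  by rewrite !big_ord0 addr0 subrr normr0.
have /andP[pn0 _] := p01 n.
rewrite !big_ord_recr/= [X in rho + X]addrC addrA.
(* The last trial is exchanged first; the induction hypothesis then starts from time [rho + p n]. *)
have /IHn IH : 0 <= rho + p n by rewrite addr_ge0.
set X := bernoulli_mean _ _ _; set Y := F _ _.
have : `|X - bernoulli_mean p n (F (rho + p n))| <= e n.
  rewrite ler_norml; apply/andP; split.
    rewrite lerNl opprB lerBlDl; apply: bernoulli_mean_leD => // j /=.
    by have := step n rho j rho0; rewrite ler_norml => /andP[]; lra.
  rewrite lerBlDl; apply: bernoulli_mean_leD => // j /=.
  by have := step n rho j rho0; rewrite ler_norml => /andP[]; lra.
move: IH; rewrite -/Y !ler_norml => /andP[? ?] /andP[? ?]; apply/andP; lra.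
Qed.

(** The probability that a Poisson variable of mean [rho] is strictly below [i]. *)
Definition poisson_sum {R : realType} (rho : R) (i : nat) : R :=
  \sum_(l < i) (rho ^+ l / l`!%:R) * expR (- rho).

Lemma poisson_sum_ge0 (R : realType) (rho : R) i : 0 <= rho -> 0 <= poisson_sum rho i.
Proof.
by move=> r0; apply: sumr_ge0 => l _; rewrite mulr_ge0 ?expR_ge0// divr_ge0 ?exprn_ge0.
Qed.

Lemma poisson_sum_le1 (R : realType) (rho : R) i : 0 <= rho -> poisson_sum rho i <= 1.
Proof.
move=> r0; rewrite /poisson_sum -mulr_suml expRN ler_pdivrMr ?expR_gt0// mul1r.
have nd : nondecreasing_seq (series (exp_coeff rho)).
  apply/nondecreasing_seqP => n; rewrite /series/= big_nat_recr//= lerDl.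
  by rewrite divr_ge0 ?exprn_ge0.
have := nondecreasing_cvgn_le nd (is_cvg_series_exp_coeff rho) i.
by rewrite /series/= big_mkord.
Qed.

(** The term of index [l] has derivative term [l - 1] minus term [l], so the sum telescopes. Written
    with [i.-1], this is the evolution equation of the Poisson flow: the time derivative equals the
    effect of a unit jump. At [i = 0] both sides vanish, the sum being empty. *)
Lemma is_derive_poisson_sum (R : realType) (rho : R) i :
  is_derive rho 1 (fun rho => poisson_sum rho i)
    (poisson_sum rho i.-1 - poisson_sum rho i).
Proof.
have dN : is_derive rho 1 (fun rho : R => expR (- rho)) (- expR (- rho)).
  have ? : is_derive rho 1 (-%R : R -> R) (-1) by apply: is_derive_eq.
  by rewrite -mulrN1; exact: is_derive1_comp.
case: i => [|i].
  rewrite subrr (_ : (fun _ => _) = cst 0); first exact: is_derive_cst.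
  by apply/funext => x; rewrite /poisson_sum big_ord0.
have -> : poisson_sum rho i - poisson_sum rho i.+1 =
    - (rho ^+ i / i`!%:R * expR (- rho)).
  by rewrite /poisson_sum big_ord_recr/= opprD addNKr.
elim: i => [|i IHi].
  rewrite (_ : (fun _ => _) = fun rho => expR (- rho)).
    by rewrite expr0 fact0 invr1 !mul1r.
  by apply/funext => x; rewrite /poisson_sum big_ord1 expr0 fact0 invr1 !mul1r.
rewrite (_ : (fun _ => _) = fun rho => poisson_sum rho i.+1 +
  i.+1`!%:R^-1 * (rho ^+ i.+1 * expR (- rho))); last first.
  by apply/funext => x; rewrite /poisson_sum [LHS]big_ord_recr/=; congr +%R; ring.
have ? : is_derive rho 1 (fun rho : R => rho ^+ i.+1 * expR (- rho))
    (i.+1%:R * rho ^+ i * expR (- rho) - rho ^+ i.+1 * expR (- rho)).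
  have dX := is_deriveM (is_deriveX i.+1 (is_derive_id rho 1)) dN.
  rewrite (_ : (fun _ => _) = (id ^+ i.+1 * (fun rho : R => expR (- rho)))).
    by apply: is_derive_eq; rewrite fctE /GRing.scale/=; ring.
  by apply/funext => x; rewrite !fctE.
have f0 : (i`!%:R : R) != 0 by rewrite pnatr_eq0 -lt0n fact_gt0.
have i0 : i.+1%:R != 0 :> R by rewrite pnatr_eq0.
apply: is_derive_eq; rewrite /GRing.scale/= factS natrM.
by field; apply/andP.
Qed.

(** By the evolution equation the exchange is the first-order expansion in [rho]; the second
    derivative is a second difference [a - 2 b + c] of numbers in [[0, 1]], hence at most 2 in
    absolute value. *)
Lemma poisson_step (R : realType) (rho p : R) i : 0 <= rho -> 0 <= p ->
  `|(1 - p) * poisson_sum rho i + p * poisson_sum rho i.-1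
    - poisson_sum (rho + p) i| <= 2 * p ^+ 2.
Proof.
move=> r0 p0.
rewrite (_ : _ - _ = - (poisson_sum (rho + p) i - poisson_sum rho i -
  p * (poisson_sum rho i.-1 - poisson_sum rho i))); last by ring.
rewrite normrN; apply: (@taylor2_bound R (fun rho => poisson_sum rho i)
  (fun rho => poisson_sum rho i.-1 - poisson_sum rho i)
  (fun rho => (poisson_sum rho i.-2 - poisson_sum rho i.-1) -
     (poisson_sum rho i.-1 - poisson_sum rho i))).
- by move=> t _; exact: is_derive_poisson_sum.
- move=> t _; apply: is_deriveB; exact: is_derive_poisson_sum.
move=> t /andP[t0 _]; have : 0 <= rho + t * p by rewrite addr_ge0// mulr_ge0.
move: (rho + _) => s s0.
have := poisson_sum_le1 R s i s0; have := poisson_sum_le1 R s i.-1 s0.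
have := poisson_sum_le1 R s i.-2 s0; have := poisson_sum_ge0 R s i s0.
have := poisson_sum_ge0 R s i.-1 s0; have := poisson_sum_ge0 R s i.-2 s0.
rewrite ler_norml => ? ? ? ? ? ?; apply/andP; lra.
Qed.

(** The exchange is run with [poisson_sum rho (J - j)] from time 0, where the Poisson variable is 0
    and this function is the indicator of [j < J]. *)
Lemma bernoulli_mean_poisson (R : realType) (p : nat -> R) n J :
  (forall i, 0 <= p i <= 1) ->
  `|bernoulli_mean p n (fun j => (j < J)%N%:R) - poisson_sum (\sum_(i < n) p i) J|
  <= 2 * \sum_(i < n) p i ^+ 2.
Proof.
move=> p01; rewrite mulr_sumr.
have step i rho j : 0 <= rho ->
    `|(1 - p i) * poisson_sum rho (J - j) + p i * poisson_sum rho (J - j.+1)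
      - poisson_sum (rho + p i) (J - j)| <= 2 * p i ^+ 2.
  by have /andP[? _] := p01 i; move=> ?; rewrite subnS; exact: poisson_step.
have := bernoulli_mean_telescope R p _ n (fun rho j => poisson_sum rho (J - j))
  p01 step 0 (lexx _).
rewrite add0r subn0; congr (`|_ - _| <= _); apply: eq_bernoulli_mean => j.
rewrite -subn_gt0; case: (J - j)%N => [|m]; first by rewrite /poisson_sum big_ord0.
rewrite /poisson_sum big_ord_recl big1 ?addr0 => [|l _].
  by rewrite expr0 fact0 oppr0 expR0 mulr1 divr1.
by rewrite expr0n/= !mul0r.
Qed.

Lemma bernoulli_mean_natr (R : realType) (p : nat -> R) n :
  bernoulli_mean p n (fun j => j%:R) = \sum_(i < n) p i.
Proof.
(* The shift [a] is needed for the induction: averaging over the last trial turns [j] into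
   [j + p n]. *)
suff H a : bernoulli_mean p n (fun j => j%:R + a) = \sum_(i < n) p i + a.
  by rewrite -[RHS]addr0 -H; apply: eq_bernoulli_mean => j; rewrite addr0.
elim: n a => [|n IHn] a /=; first by rewrite big_ord0.
rewrite big_ord_recr/= -addrA -IHn; apply: eq_bernoulli_mean => j.
by rewrite -natr1; ring.
Qed.

(** * Central limit theorem for Bernoulli sums *)

Lemma cvg_close (R : realType) (u v w : nat -> R) (l : R) :
  (\forall n \near \oo, `|u n - v n| <= w n) -> w n @[n --> \oo] --> (0 : R) ->
  v n @[n --> \oo] --> l -> u n @[n --> \oo] --> l.
Proof.
move=> uvw w0 vl; apply/subr_cvg0.
rewrite (_ : (fun _ => _) = (fun n => (u n - v n) + (v n - l))); last first.
  by apply/funext => n; rewrite addrA subrK.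
rewrite -[X in _ --> X]addr0; apply: cvgD; last exact/subr_cvg0.
apply/norm_cvg0P; apply: squeeze_cvgr w0; last exact: cvg_cst.
by near=> n; rewrite normr_ge0/=; near: n.
Unshelve. all: by end_near. Qed.

Lemma bounded_cvg0 (R : realType) (u v : nat -> R) (K : R) :
  (\forall n \near \oo, `|u n| <= K) -> v n @[n --> \oo] --> 0 ->
  v n * u n @[n --> \oo] --> 0.
Proof.
move=> uK v0.
have K0 : (fun n => `|v n| * K) @ \oo --> 0.
  by rewrite -(mul0r K); apply: cvgMl; rewrite -(normr0 R); exact: cvg_norm.
apply/norm_cvg0P; apply: squeeze_cvgr K0; last exact: cvg_cst.
near=> n; rewrite normr_ge0/= normrM ler_wpM2l//.
by near: n.
Unshelve. all: by end_near. Qed.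

Lemma cvg_inv_sqrt (R : realType) (L : nat -> R) : L @ \oo --> +oo ->
  (Num.sqrt (L n))^-1 @[n --> \oo] --> 0.
Proof.
move=> Loo; apply/cvgrPdist_le => e e0.
have e2 : 0 < e^-1 ^+ 2 by rewrite exprn_gt0// invr_gt0.
near=> n; rewrite sub0r normrN ger0_norm ?invr_ge0 ?sqrtr_ge0//.
have Ln : e^-1 ^+ 2 <= L n by near: n; exact: (proj1 (cvgryPge _) Loo).
rewrite -[leRHS]invrK lef_pV2 ?posrE ?invr_gt0// ?sqrtr_gt0 ?(lt_le_trans e2)//.
by rewrite -(ger0_norm (ltW (_ : 0 < e^-1))) ?invr_gt0// -sqrtr_sqr ler_wsqrtr.
Unshelve. all: by end_near. Qed.

(** The heat flow starts with [B = eps * L] and [A = tau * L + y * sqrt L - 1], the [- 1]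
    anticipating that the containment level is one plus the Bernoulli sum. After time [lam], within
    [K] of [tau * L], its argument tends to [y / sqrt (eps + tau)]; the accumulated error is
    [O(1 / L + 1 / sqrt L)]. *)
Lemma cvg_bernoulli_mean_smooth (R : realType) (Phi : R -> R) (c tau K : R)
    (p : nat -> nat -> R) (N : nat -> nat) (L : nat -> R) :
  0 <= c -> (forall y : R, is_derive y 1 Phi (c * expR (- (y ^+ 2 / 2)))) ->
  0 < tau ->
  (forall n i, 0 <= p n i <= 1) -> L @ \oo --> +oo ->
  (\forall n \near \oo, `|\sum_(i < N n) p n i - tau * L n| <= K) ->
  (\forall n \near \oo, \sum_(i < N n) p n i ^+ 2 <= K) ->
  forall eps y : R, 0 < eps ->
  bernoulli_mean (p n) (N n) (fun j =>
    Phi ((tau * L n + y * Num.sqrt (L n) - 1 - j%:R) / Num.sqrt (eps * L n)))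
  @[n --> \oo] --> Phi (y / Num.sqrt (eps + tau)).
Proof.
move=> c0 dPhi tau0 p01 Loo lK vK eps y eps0.
pose r n := (Num.sqrt (L n))^-1.
have r0 : r @ \oo --> 0 by exact: cvg_inv_sqrt.
pose lam n := \sum_(i < N n) p n i.
pose d n := lam n - tau * L n.
have rd0 : r n * d n @[n --> \oo] --> 0 by exact: bounded_cvg0 lK r0.
(* This is the final argument [(A - lam) / sqrt (B + lam)], numerator and denominator divided by
   [sqrt (L n)]. *)
pose z n := (y - r n - r n * d n) / Num.sqrt (eps + tau + r n * (r n * d n)).
have zcvg : z @ \oo --> y / Num.sqrt (eps + tau).
  apply: cvgM.
    rewrite -[X in _ --> X]subr0 -[X in _ --> X - _]subr0.
    by apply: cvgB => //; apply: cvgB => //; exact: cvg_cst.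
  apply: cvgV; first by rewrite gt_eqF// sqrtr_gt0 addr_gt0.
  apply: continuous_cvg; first exact: sqrt_continuous.
  rewrite -[X in _ --> X]addr0; apply: cvgD; first exact: cvg_cst.
  by rewrite -(mul0r 0); exact: cvgM.
have Pcvg : Phi (z n) @[n --> \oo] --> Phi (y / Num.sqrt (eps + tau)).
  apply: continuous_cvg => //; apply/differentiable_continuous/derivable1_diffP.
  by have [] := dPhi (y / Num.sqrt (eps + tau)).
(* The two errors of [heat_step] summed over the trials, with the sum of squares at most [K], the
   sum of the [p n i] at most [tau * L n + K], and [r n ^+ 2 = 1 / L n]. *)
pose e n := (40 * c / eps * K) * r n ^+ 2 +
   16 * c * (Num.sqrt eps)^-1 ^+ 3 * (tau + K * r n ^+ 2) * r n.
have e0 : e @ \oo --> 0.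
  have r20 : r n ^+ 2 @[n --> \oo] --> 0.
    by rewrite -(mul0r 0); exact: cvgM.
  have z0 : 0 = (40 * c / eps * K) * 0 +
      16 * c * (Num.sqrt eps)^-1 ^+ 3 * (tau + K * 0) * 0 by ring.
  rewrite [X in _ --> X]z0.
  apply: cvgD; first by apply: cvgM; [exact: cvg_cst|exact: r20].
  apply: cvgM; last exact: r0.
  apply: cvgM; first exact: cvg_cst.
  apply: cvgD; first exact: cvg_cst.
  by apply: cvgM; [exact: cvg_cst|exact: r20].
apply: (cvg_close _ _ _ _ _ _ e0 Pcvg).
near=> n.
have L1 : 1 <= L n by near: n; exact: (proj1 (cvgryPge _) Loo).
have Le : 1 <= eps * L n.
  rewrite mulrC -ler_pdivrMr// div1r; near: n; exact: (proj1 (cvgryPge _) Loo).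
have L0 : 0 < L n by exact: lt_le_trans L1.
have s0 : Num.sqrt (L n) != 0 by rewrite gt_eqF// sqrtr_gt0.
have r2 : r n ^+ 2 = (L n)^-1 by rewrite exprVn sqr_sqrtr// ltW.
pose F rho (j : nat) := Phi ((tau * L n + y * Num.sqrt (L n) - 1 - j%:R - rho)
  / Num.sqrt (eps * L n + rho)).
have step i rho j : 0 <= rho ->
    `|(1 - p n i) * F rho j + p n i * F rho j.+1 - F (rho + p n i) j| <=
    40 * c / (eps * L n) * p n i ^+ 2
    + 16 * c * (Num.sqrt (eps * L n))^-1 ^+ 3 * p n i.
  move=> rho0; have /andP[? _] := p01 n i.
  rewrite /F -natr1; exact: heat_step.
have := bernoulli_mean_telescope R (p n) _ (N n) F (p01 n) step 0 (lexx _).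
rewrite add0r -/(lam n).
rewrite (_ : F (lam n) 0%N = Phi (z n)); last first.
  rewrite /F /z; congr Phi; rewrite subr0.
  have -> : eps + tau + r n * (r n * d n) = (eps * L n + lam n) * r n ^+ 2.
    rewrite mulrA -expr2 r2 /d; field; exact: lt0r_neq0.
  have q0 : 0 < eps * L n + lam n.
    rewrite ltr_wpDr ?(lt_le_trans _ Le)// sumr_ge0// => i _.
    by have /andP[] := p01 n i.
  rewrite sqrtrM ?ltW// sqrtr_sqr ger0_norm ?invr_ge0 ?sqrtr_ge0//.
  have q1 : Num.sqrt (eps * L n + lam n) != 0 by rewrite gt_eqF// sqrtr_gt0.
  rewrite /r /d; move: q1 s0; move: (Num.sqrt (eps * L n + lam n)) => q q1.
  by move: (Num.sqrt (L n)) => s s0'; field; apply/andP.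
have F0 j : F 0 j =
  Phi ((tau * L n + y * Num.sqrt (L n) - 1 - j%:R) / Num.sqrt (eps * L n)).
  by rewrite /F subr0 addr0.
rewrite (eq_bernoulli_mean _ _ _ _ _ F0) => /le_trans; apply.
rewrite big_split/= -!mulr_sumr -/(lam n) /e.
have lamK : lam n <= tau * L n + K.
  rewrite -lerBlDl (le_trans (ler_norm _))//; near: n; exact: lK.
have sq : (Num.sqrt (eps * L n))^-1 = (Num.sqrt eps)^-1 * r n.
  by rewrite sqrtrM ?ltW// invfM.
rewrite lerD//.
  rewrite invfM -r2 (_ : 40 * c / eps * K * r n ^+ 2 =
    40 * c * (eps^-1 * r n ^+ 2) * K); last by ring.
  rewrite ler_wpM2l//; last by near: n.
  apply: mulr_ge0; first by rewrite mulr_ge0.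
  by apply: mulr_ge0; [rewrite invr_ge0 ltW|exact: sqr_ge0].
rewrite sq exprMn; apply: (@le_trans _ _ (16 * c * ((Num.sqrt eps)^-1 ^+ 3 * r n ^+ 3)
  * (tau * L n + K))).
  apply: ler_wpM2l => //; apply: mulr_ge0; first by rewrite mulr_ge0.
  by apply: mulr_ge0; rewrite exprn_ge0// invr_ge0 sqrtr_ge0.
have -> : r n ^+ 3 = r n ^+ 2 * r n by rewrite exprSr.
rewrite le_eqVlt; apply/orP; left; apply/eqP; rewrite r2.
set q := (Num.sqrt eps)^-1; field; exact: lt0r_neq0.
Unshelve. all: by end_near. Qed.

(** The indicator at [x] lies, up to a small error, between smoothed indicators at [x - D] and
    [x + D]. With a smoothing width of [D / M] on the normalized scale, a shift by [D] moves the
    argument of [Phi] past [M] or [- M], where only a small tail remains. *)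
Lemma bernoulli_clt (R : realType) (Phi : R -> R) (c tau K : R)
    (p : nat -> nat -> R) (N : nat -> nat) (L : nat -> R) :
  0 <= c -> (forall y : R, is_derive y 1 Phi (c * expR (- (y ^+ 2 / 2)))) ->
  Phi x @[x --> -oo] --> (0 : R) -> Phi x @[x --> +oo] --> (1 : R) ->
  0 < tau ->
  (forall n i, 0 <= p n i <= 1) -> L @ \oo --> +oo ->
  (\forall n \near \oo, `|\sum_(i < N n) p n i - tau * L n| <= K) ->
  (\forall n \near \oo, \sum_(i < N n) p n i ^+ 2 <= K) ->
  forall x : R,
  bernoulli_mean (p n) (N n) (fun j =>
    ((1 + j%:R - tau * L n) / Num.sqrt (L n) <= x)%R%:R)
  @[n --> \oo] --> Phi (x / Num.sqrt tau).
Proof.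
move=> c0 dPhi PhiN Phiy tau0 p01 Loo lK vK x.
have cPhi y : {for y, continuous Phi}.
  apply/differentiable_continuous/derivable1_diffP.
  by have [] := dPhi y.
have ndPhi : {homo Phi : y z / y <= z}.
  move=> y z yz; have [|u _ E] := @MVT_segment R Phi
    (fun y => c * expR (- (y ^+ 2 / 2))) y z yz (fun u _ => dPhi u).
    exact: continuous_subspaceT.
  by rewrite -subr_ge0 E !mulr_ge0 ?expR_ge0// subr_ge0.
have Phi0 y : 0 <= Phi y.
  rewrite leNgt; apply/negP => Py.
  have : \forall z \near -oo, Phi y < Phi z by exact: (cvgr_gt _ PhiN).
  move=> H; have [z] := filter_ex (filterI H (nbhs_ninfty_le (num_real y))).
  by case=> /lt_le_trans + /ndPhi => /[apply]; rewrite ltxx.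
have Phi1 y : Phi y <= 1.
  rewrite leNgt; apply/negP => Py.
  have : \forall z \near +oo, Phi z < Phi y by exact: (cvgr_lt _ Phiy).
  move=> H; have [z] := filter_ex (filterI H (nbhs_pinfty_ge (num_real y))).
  by case=> /le_lt_trans H1 /ndPhi /H1; rewrite ltxx.
apply/cvgrPdist_le => e0 e00; pose e := e0 / 3.
have e_gt0 : 0 < e by rewrite divr_gt0.
have [M [M0 [PM PNM]]] : exists M, 0 < M /\ (1 - e <= Phi M /\ Phi (- M) <= e).
  have H1 : \forall z \near +oo, 1 - e <= Phi z.
    by apply: (cvgr_ge _ Phiy); rewrite ltrBlDr ltrDl.
  have H2 : \forall z \near -oo, Phi z <= e by exact: (cvgr_le _ PhiN).
  have [z1 Pz1] := filter_ex H1; have [z2 Pz2] := filter_ex H2.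
  exists (Num.max 1 (Num.max z1 (- z2))); split; first by rewrite lt_max ltr01.
  split; first by rewrite (le_trans Pz1)// ndPhi// !le_max lexx orbT.
  by rewrite (le_trans _ Pz2)// ndPhi// lerNl !le_max lexx !orbT.
(* [g D] is the limit of the smoothed means at [x + D] for [eps = (D / M) ^ 2]: with [M] fixed,
   shift and width vanish together as [D] tends to 0. *)
pose g D := Phi ((x + D) / Num.sqrt ((D / M) ^+ 2 + tau)).
have g0 : g 0 = Phi (x / Num.sqrt tau) by rewrite /g mul0r addr0 expr0n/= add0r.
have gc : {for 0, continuous g}.
  rewrite /g; apply: continuous_comp; last exact: cPhi.
  apply: cvgM.
    by apply: cvgD; [exact: cvg_cst|exact: cvg_id].
  apply: cvgV; first by rewrite mul0r expr0n/= add0r gt_eqF// sqrtr_gt0.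
  apply: continuous_cvg; first exact: sqrt_continuous.
  apply: cvgD; last exact: cvg_cst.
  by apply: cvgM; apply: cvgM; (exact: cvg_id || exact: cvg_cst).
have [D [D0 [gD gND]]] : exists D, 0 < D /\
    (`|g 0 - g D| <= e /\ `|g 0 - g (- D)| <= e).
  move/cvgrPdist_le : gc => /(_ e e_gt0) /nbhs_ballP[D /= D0 H].
  have D20 : 0 < D / 2 by rewrite divr_gt0.
  exists (D / 2); split => //; split; apply: H; rewrite /ball/= sub0r normrN.
    by rewrite gtr0_norm// ltr_pdivrMr//; lra.
  by rewrite normrN gtr0_norm// ltr_pdivrMr//; lra.
have eps0 : 0 < (D / M) ^+ 2 by rewrite exprn_gt0// divr_gt0.
have cv y := cvg_bernoulli_mean_smooth R Phi c tau K p N L c0 dPhi tau0 p01 Loo lK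
  vK ((D / M) ^+ 2) y eps0.
have /cvgrPdist_le/(_ e e_gt0) cvD := cv (x + D).
have /cvgrPdist_le/(_ e e_gt0) cvND := cv (x - D).
have gNDE : g (- D) = Phi ((x - D) / Num.sqrt ((D / M) ^+ 2 + tau)).
  by rewrite /g mulNr sqrrN.
near=> n.
have Ln0 : 0 < L n.
  have : 1 <= L n by near: n; exact: (proj1 (cvgryPge _) Loo).
  exact: lt_le_trans.
have s0 : 0 < Num.sqrt (L n) by rewrite sqrtr_gt0.
have sE : Num.sqrt ((D / M) ^+ 2 * L n) = D / M * Num.sqrt (L n).
  by rewrite sqrtrM ?ltW// sqrtr_sqr ger0_norm// ltW// divr_gt0.
have q0 : 0 < D / M * Num.sqrt (L n) by rewrite mulr_gt0// divr_gt0.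
have MqE : M * (D / M * Num.sqrt (L n)) = D * Num.sqrt (L n).
  by field; exact: lt0r_neq0.
set B := bernoulli_mean _ _ _.
have up : B <= bernoulli_mean (p n) (N n) (fun j =>
    Phi ((tau * L n + (x + D) * Num.sqrt (L n) - 1 - j%:R)
    / Num.sqrt ((D / M) ^+ 2 * L n))) + e.
  apply: bernoulli_mean_leD => // j /=; rewrite sE.
  (* Where the indicator is 1, the numerator is at least [D * sqrt (L n)], that is [M] times the
     denominator, so [Phi] is at least [1 - e] there. *)
  have [h|_] := boolP (_ <= x); last by rewrite addr_ge0// ltW.
  rewrite ler_pdivrMr// in h.
  rewrite /= -lerBlDr (le_trans PM)// ndPhi// ler_pdivlMr// MqE mulrDl; lra.
have lo : bernoulli_mean (p n) (N n) (fun j =>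
    Phi ((tau * L n + (x - D) * Num.sqrt (L n) - 1 - j%:R)
    / Num.sqrt ((D / M) ^+ 2 * L n))) <= B + e.
  apply: bernoulli_mean_leD => // j /=; rewrite sE.
  have [h|h] := boolP (_ <= x); first by rewrite ler_wpDr// ltW.
  rewrite -ltNge ltr_pdivlMr// in h.
  rewrite add0r (le_trans _ PNM)// ndPhi// ler_pdivrMr// mulNr MqE mulrBl; lra.
have h1 : `|g D - bernoulli_mean (p n) (N n) (fun j =>
    Phi ((tau * L n + (x + D) * Num.sqrt (L n) - 1 - j%:R)
    / Num.sqrt ((D / M) ^+ 2 * L n)))| <= e by near: n; exact: cvD.
have h2 : `|g (- D) - bernoulli_mean (p n) (N n) (fun j =>
    Phi ((tau * L n + (x - D) * Num.sqrt (L n) - 1 - j%:R)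
    / Num.sqrt ((D / M) ^+ 2 * L n)))| <= e by rewrite gNDE; near: n; exact: cvND.
rewrite -g0; have e3 : e0 = 3 * e by rewrite /e; field.
move: h1 h2 gD gND; rewrite !ler_norml => /andP[? ?] /andP[? ?] /andP[? ?] /andP[? ?].
by apply/andP; lra.
Unshelve. all: by end_near. Qed.

(** * Law of the containment level *)

(** The vertex is a natural number, so that one vertex can be followed through the ordinal types
    ['I_(m + theta)] that grow with [m]. *)
Definition hit {theta : nat} (c : choices theta) (v m : nat) : bool :=
  v \in [fset val i | i in c m]%fset.

Lemma hyperedge_max (theta : nat) (c : choices theta) (m v : nat) :
  v \in hyperedge c m.+1 -> (v <= m + theta)%N.
Proof.
rewrite /= in_fsetU in_fset1 => /orP[/eqP->//|/imfsetP[i /= _ ->]].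
exact: ltnW (ltn_ord i).
Qed.

(** A hyperedge is identified by its largest element: the one of time [m.+1] has maximum
    [m + theta], and the first one stays below [theta]. Hence the cardinality of a set of hyperedges
    is a number of insertion times. *)
Lemma hyperedge_inj (theta : nat) (c : choices theta) :
  injective (hyperedge c).
Proof.
have top m : (m + theta)%N \in hyperedge c m.+1 by rewrite /= fset1U1.
have lt0 m v : v \in hyperedge c 0 -> (v < m + theta)%N.
  by rewrite !inE/= mem_iota add0n => /andP[_ vt]; rewrite ltn_addl.
move=> [|i] [|j] // E.
- by have := top j; rewrite -E => /(lt0 j); rewrite ltnn.
- by have := top i; rewrite E => /(lt0 i); rewrite ltnn.
have := top i; rewrite E => /hyperedge_max; rewrite leq_add2r => ij.
have := top j; rewrite -E => /hyperedge_max; rewrite leq_add2r => ji.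
by congr _.+1; apply/eqP; rewrite eqn_leq ij.
Qed.

Lemma containmentE (theta : nat) (c : choices theta) (r : 'I_theta) (n k : nat) :
  containment c r n k =
  count (fun j => vertex r k \in hyperedge c j) (iota 0 n.+1).
Proof.
rewrite /containment -size_filter.
set s := [seq _ <- _ | _].
rewrite (_ : [fset e in _ | _]%fset = [fset e in map (hyperedge c) s]%fset).
  rewrite card_fseq undup_id ?size_map// map_inj_uniq ?filter_uniq ?iota_uniq//.
  exact: hyperedge_inj.
apply/fsetP => e; rewrite !inE/=; apply/andP/mapP.
  move=> [/imfsetP[j /= jn ->] vj]; exists j => //.
  by rewrite mem_filter vj.
move=> [j]; rewrite mem_filter => /andP[vj jn] ->; split => //.
by apply/imfsetP; exists j.
Qed.

Lemma vertex_lt (theta : nat) (r : 'I_theta) (k m : nat) : (k <= m)%N ->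
  (vertex r k < m + theta)%N.
Proof.
case: k => [|k] /= km; first by rewrite ltn_addl.
by rewrite ltn_add2r.
Qed.

Lemma vertex_in_hyperedge (theta : nat) (c : choices theta) (r : 'I_theta) (k j : nat) :
  vertex r k \in hyperedge c j =
  if (j < k)%N then false else if j == k then true else hit c (vertex r k) j.-1.
Proof.
case: (ltngtP j k) => [jk|kj|->].
- case: k jk => // k; rewrite ltnS => jk; apply/negbTE/negP.
  case: j jk => [_|j jk /hyperedge_max].
    by rewrite !inE/= mem_iota add0n => /andP[_]; rewrite ltnNge leq_addl.
  by rewrite /= leq_add2r leqNgt jk.
- case: j kj => // j kj; rewrite /= in_fsetU in_fset1 -/(hit c (vertex r k) j).
  by rewrite ltn_eqF// vertex_lt.
case: k => [|k]; last by rewrite /= fset1U1.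
by rewrite !inE/= mem_iota/= add0n ltn_ord.
Qed.

(** The leading 1 is the hyperedge formed when vertex [k] enters, the first hyperedge if [k = 0];
    none before contains it, and the later hyperedge [(k + i).+1] is decided by the choice of index
    [k + i]. *)
Lemma containment_sum (theta : nat) (c : choices theta) (r : 'I_theta) (k N : nat) :
  containment c r (k + N) k = (1 + \sum_(i < N) hit c (vertex r k) (k + i))%N.
Proof.
rewrite containmentE (eq_count (vertex_in_hyperedge _ c r k)).
elim: N => [|N IHN]; last first.
  rewrite addnS -(addn1 (k + N).+1) iotaD count_cat IHN big_ord_recr/=.
  rewrite addn0 add0n ltnNge leqW ?leq_addr//=.
  by rewrite gtn_eqF ?ltnS ?leq_addr// addnA.
rewrite addn0 big_ord0 addn0 -(addn1 k) iotaD count_cat/= addn0 add0n.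
rewrite ltnn eqxx addn1; congr _.+1.
apply/eqP; rewrite -leqn0 leqNgt -has_count; apply/hasPn => j.
by rewrite mem_iota add0n => /andP[_ ->].
Qed.

(** Subsets avoiding [x] are the subsets of its complement, so Pascal's rule counts those containing
    [x]; the absorption identity [n C(n-1, t) = (t+1) C(n, t+1)] concludes, in a form free of
    division. *)
Lemma card_draws_mem (I : finType) (x : I) (t : nat) :
  (#|I| * #|[set A : {set I} | (#|A| == t.+1) && (x \in A)]%SET| =
   t.+1 * 'C(#|I|, t.+1))%N.
Proof.
rewrite -mul_bin_diag; congr muln.
have I0 : (0 < #|I|)%N by apply/card_gt0P; exists x.
have := cards_draws (~: [set x])%SET t.+1; rewrite cardsC1.
have := card_draws I t.+1; rewrite -(prednK I0) binS /= => e1 e2.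
rewrite -(cardsID [set A : {set I} | x \in A]%SET) addnC in e1.
move/eqP: e1; rewrite (_ : _ :\: _ =
  [set A : {set I} | (A \subset ~: [set x]) && (#|A| == t.+1)])%SET.
  rewrite e2 eqn_add2l => /eqP <-; apply: eq_card => A.
  by rewrite !inE.
by apply/setP => A; rewrite !inE finset.subsetC finset.sub1set !inE.
Qed.

Lemma sum_uniform_mem (R : realType) (M t : nat) (v : 'I_M) : (t < M)%N ->
  \sum_(A : {set 'I_M} | v \in A)
    (if #|A| == t.+1 then 'C(M, t.+1)%:R^-1 else 0) = t.+1%:R / M%:R :> R.
Proof.
move=> tM; rewrite -big_mkcondr/=.
pose D := [set A : {set 'I_M} | (#|A| == t.+1) && (v \in A)]%SET.
rewrite (eq_bigl (fun A => A \in D)); last by move=> A; rewrite !inE andbC.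
rewrite sumr_const -/D.
have M0 : (0 < M)%N by apply: leq_ltn_trans (ltn_ord v).
have C0 : 'C(M, t.+1)%:R != 0 :> R by rewrite pnatr_eq0 -lt0n bin_gt0.
have M0' : M%:R != 0 :> R by rewrite pnatr_eq0 -lt0n.
have := card_draws_mem _ v t; rewrite card_ord -/D.
move=> /(congr1 (fun n => n%:R : R)); rewrite !natrM => E.
rewrite -[LHS]mulr_natl; apply/eqP; rewrite eqr_div//; apply/eqP.
by rewrite mulrC E.
Qed.

Lemma probability_partition d (T : measurableType d) (R : realType)
    (P : probability T R) (I : finType) (X : T -> I) (D : set T) :
  (forall i, measurable (X @^-1` [set i])) -> measurable D ->
  fine (P D) = \sum_(i : I) fine (P (D `&` X @^-1` [set i])).
Proof.
move=> mX mD; rewrite -[in LHS](setIT D).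
have -> : setT = \bigcup_(i in [set: I]) X @^-1` [set i].
  by apply/seteqP; split => // w _; exists (X w).
rewrite setI_bigcupr measure_fin_bigcup//.
- rewrite (_ : [set: I] = [set` index_enum I]).
    rewrite -fsbig_seq ?index_enum_uniq// -sum_fine//= => i _.
    by rewrite fin_num_measure//; exact: measurableI.
  by apply/seteqP; split => // i _; rewrite /= mem_index_enum.
- exact: finite_finset.
- by move=> i j _ _ [w [[_ <-] [_ <-]]].
- by move=> i _; exact: measurableI.
Qed.

(** There are finitely many histories before time [m], and an event determined by the history is a
    finite union of the corresponding cylinders. *)
Lemma measurable_past d (T : measurableType d) (R : realType)
    (P : probability T R) (theta : nat) (H : hyperrecursive_tree P theta)
    (m : nat) (E : set T) :
  (forall w w', (forall j, (j < m)%N -> chosen H j w = chosen H j w') ->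
    E w -> E w') ->
  measurable E.
Proof.
move=> past.
pose hist w : {dffun forall j : 'I_m, {set 'I_(j + theta)}} :=
  [ffun j : 'I_m => chosen H j w].
rewrite (_ : E = \bigcup_(c in hist @` E)
    \bigcap_(j in [set: 'I_m]) (chosen H j @^-1` [set (c j)])).
  apply: fin_bigcup_measurable => [|c _]; first exact: finite_finset.
  apply: fin_bigcap_measurable => // j _; exact: measurable_chosen.
apply/seteqP; split=> [w Ew|w [_ [w' Ew' <-]] h].
  by exists (hist w) => [|j _ /=]; [exists w | rewrite ffunE].
apply: past Ew' => j jm; have := h (Ordinal jm) I; by rewrite /= ffunE.
Qed.

(** A hit is independent of every event [E] of the past. Both sides are split along the complete
    histories and the left one also along the chosen set [A]; [chosen_uniform] factors each piece,
    and the weights of the [A] containing [v] add up to the ratio. *)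
Lemma past_hit_probability d (T : measurableType d) (R : realType)
    (P : probability T R) (theta : nat) (H : hyperrecursive_tree P theta)
    (m v : nat) (E : set T) : (2 <= theta)%N -> (v < m + theta)%N ->
  (forall w w', (forall j, (j < m)%N -> chosen H j w = chosen H j w') ->
    E w -> E w') ->
  fine (P (E `&` [set w | hit (fun j => chosen H j w) v m])) =
  (theta%:R - 1) / (m + theta)%:R * fine (P E).
Proof.
move=> theta2 vm past.
pose hist w : {dffun forall j : 'I_m, {set 'I_(j + theta)}} :=
  [ffun j : 'I_m => chosen H j w].
have histP w c : hist w = c <-> (forall j : 'I_m, chosen H j w = c j).
  split=> [<- j|h]; first by rewrite ffunE.
  by apply/ffunP => j; rewrite ffunE.
have mpre (c : {dffun forall j : 'I_m, {set 'I_(j + theta)}}) :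
    measurable (hist @^-1` [set c]).
  apply: (@measurable_past _ _ _ _ _ H m) => w w' ww' /= <-.
  by apply/ffunP => j; rewrite !ffunE ww'.
have mE : measurable E by exact: measurable_past past.
have hitE w : hit (fun j => chosen H j w) v m = (Ordinal vm \in chosen H m w).
  apply/imfsetP/idP => [[i /= iC vi]|vC]; last by exists (Ordinal vm).
  by rewrite (_ : Ordinal vm = i)//; exact: val_inj.
have mhit : measurable [set w | hit (fun j => chosen H j w) v m].
  apply: (@measurable_past _ _ _ _ _ H m.+1) => w w' ww' /=.
  by rewrite !hitE ww'.
pose u (A : {set 'I_(m + theta)}) : R :=
  if #|A| == theta.-1 then 'C(m + theta, theta.-1)%:R^-1 else 0.
have Eu c A : fine (P (E `&` [set w | hit (fun j => chosen H j w) v m] `&`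
    hist @^-1` [set c] `&` chosen H m @^-1` [set A])) =
  (Ordinal vm \in A)%:R * u A * fine (P (E `&` hist @^-1` [set c])).
  have [vA|vA] := boolP (Ordinal vm \in A); last first.
    rewrite !mul0r (_ : _ `&` _ = set0) ?measure0//.
    apply/seteqP; split => // w [[[_ /= h] _] /= wA].
    by move: h; rewrite hitE wA (negbTE vA).
  (* [chosen_uniform] expects an infinite sequence of choices, whereas [c] has only [m] entries; an
     outcome [w0] with history [c] provides one. Without such an outcome in [E], both sides are
     0. *)
  have [[w0 [Ew0 hw0]]|no] := pselect (exists w, E w /\ hist w = c); last first.
    rewrite (_ : _ `&` _ = set0); last first.
      by apply/seteqP; split => // w [[[Ew _] hw] _]; apply: no; exists w.
    rewrite [in RHS](_ : _ `&` _ = set0) ?measure0 ?mulr0//.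
    by apply/seteqP; split => // w [Ew hw]; apply: no; exists w.
  have pastE w : hist w = c <-> (forall j, (j < m)%N -> chosen H j w = chosen H j w0).
    split=> [hw j jm|h].
      have := (histP w0 c).1 hw0 (Ordinal jm); have := (histP w c).1 hw (Ordinal jm).
      by move=> /= -> ->.
    by rewrite -hw0; apply/ffunP => j; rewrite !ffunE h.
  have cE : hist @^-1` [set c] =
      [set w | forall j, (j < m)%N -> chosen H j w = chosen H j w0].
    by apply/seteqP; split => w /=; rewrite pastE.
  (* [E] depends on the history only, so it contains the whole atom as soon as it contains [w0]. *)
  have -> : E `&` hist @^-1` [set c] = hist @^-1` [set c].
    apply/setIidr => w; rewrite cE /= => h; apply: past Ew0 => j jm; by rewrite h.
  rewrite (_ : _ `&` _ = [set w | chosen H m w = A] `&` hist @^-1` [set c]).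
    rewrite cE (chosen_uniform H A (fun j => chosen H j w0)) -cE mul1r fineM//.
    by rewrite fin_num_measure.
  apply/seteqP; split => w /=; first by case=> [[_ ->] ->].
  move=> [hA hw]; split => //; split => //; split; last by rewrite hitE hA.
  by have := hw; rewrite pastE => h; apply: past Ew0 => j jm; rewrite h.
rewrite (probability_partition _ _ _ _ _ hist)//; last exact: measurableI.
rewrite [in RHS](probability_partition _ _ _ P _ hist)// mulr_sumr.
apply: eq_bigr => c _.
rewrite (probability_partition _ _ _ _ _ (chosen H m)); last 2 first.
- exact: measurable_chosen.
- by apply: measurableI => //; exact: measurableI.
under eq_bigr do rewrite Eu.
rewrite -mulr_suml; congr (_ * _).
rewrite (eq_bigr (fun A : {set 'I_(m + theta)} =>
    if Ordinal vm \in A then u A else 0)); last first.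
  by move=> A _; case: ifP => _; rewrite ?mul1r ?mul0r.
have tE : theta = theta.-2.+2 by case: (theta) theta2 => [|[]].
rewrite -big_mkcond/= /u (_ : theta.-1 = theta.-2.+1); last by rewrite [in LHS]tE.
rewrite sum_uniform_mem.
  by congr (_ / _); rewrite [in RHS]tE -[theta.-2.+2%:R]natr1 addrK.
by rewrite {2}tE !addnS ltnS leqW ?leq_addl.
Qed.

(** The probability that vertex [k] is chosen at time [(k + i).+1], when
    [k + i + theta] vertices exist. *)
Definition choice_probability (R : realType) (theta k i : nat) : R :=
  (theta%:R - 1) / (k + i + theta)%:R.

Lemma choice_probability_itv (R : realType) (theta k i : nat) : (2 <= theta)%N ->
  0 <= choice_probability R theta k i <= 1.
Proof.
move=> t2; have t1 : 1 <= theta%:R :> R by rewrite ler1n ltnW.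
have D0 : 0 < (k + i + theta)%:R :> R by rewrite ltr0n addn_gt0 (ltnW t2) orbT.
rewrite /choice_probability divr_ge0 ?subr_ge0 ?(ltW D0)//=.
by rewrite ler_pdivrMr// mul1r natrD lerBlDr -addrA addrCA lerDl addr_ge0.
Qed.

(** Induction on the number of trials, for all predicates of the partial sum at once: splitting on
    the last trial leads from [V] to [V] and its shift by one, as in the recursion of
    [bernoulli_mean], and [past_hit_probability] gives the weights. *)
Lemma containment_level_law d (T : measurableType d) (R : realType)
    (P : probability T R) (theta : nat) (H : hyperrecursive_tree P theta)
    (r : 'I_theta) (n k : nat) (U : pred nat) : (2 <= theta)%N -> (k <= n)%N ->
  P [set w | U (containment_level H r n k w)] =
  (bernoulli_mean (choice_probability R theta k) (n - k)
    (fun j => (U j.+1)%:R))%:E.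
Proof.
move=> theta2 kn; rewrite -{1}(subnKC kn).
pose S N w := (\sum_(i < N) hit (fun m => chosen H m w) (vertex r k) (k + i))%N.
have past N (V : pred nat) w w' :
    (forall j, (j < k + N)%N -> chosen H j w = chosen H j w') ->
    V (S N w) -> V (S N w').
  move=> ww'; rewrite /S (eq_bigr (fun i : 'I_N =>
    nat_of_bool (hit (fun m => chosen H m w') (vertex r k) (k + i))))// => i _.
  by rewrite /hit ww'// ltn_add2l.
have mS N (V : pred nat) : measurable [set w | V (S N w)].
  by apply: (@measurable_past _ _ _ _ _ H (k + N)) => w w' /past; exact.
have law N (V : pred nat) : fine (P [set w | V (S N w)]) =
    bernoulli_mean (choice_probability R theta k) N (fun j => (V j)%:R).
  elim: N V => [|N IHN] V.
    rewrite /S /=; have [V0|V0] := boolP (V 0%N).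
      rewrite (_ : mkset _ = setT) ?probability_setT//.
      by apply/seteqP; split => // w _; rewrite /= big_ord0.
    rewrite (_ : mkset _ = set0) ?measure0//.
    by apply/seteqP; split => // w; rewrite /= big_ord0 (negbTE V0).
  rewrite /= bernoulli_mean_lin -!IHN mulrBl mul1r.
  set h := [set w | hit (fun m => chosen H m w) (vertex r k) (k + N)].
  have mh : measurable h.
    by apply: (@measurable_past _ _ _ _ _ H (k + N).+1) => w w' ww'; rewrite /h/= /hit ww'.
  have hp (W : pred nat) : fine (P ([set w | W (S N w)] `&` h)) =
      choice_probability R theta k N * fine (P [set w | W (S N w)]).
    apply: past_hit_probability => //; first exact: vertex_lt (leq_addr _ _).
    by move=> w w' /past; exact.
  have -> : [set w | V (S N.+1 w)] = ([set w | V (S N w)] `\` h) `|`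
      ([set w | V (S N w).+1] `&` h).
    apply/seteqP; split => w; rewrite /= /S big_ord_recr/= /h/=.
      case: (hit _ _ _); rewrite ?addn1 ?addn0 => VS; first by right.
      by left.
    case: (hit _ _ _); rewrite ?addn1 ?addn0; case=> -[VS ht] //.
  have mV : measurable ([set w | V (S N w)] `&` h) by exact: measurableI.
  have mV1 : measurable ([set w | V (S N w).+1] `&` h).
    by apply: measurableI => //; exact: (mS _ (fun j => V j.+1)).
  have mVD : measurable ([set w | V (S N w)] `\` h) by exact: measurableD.
  have dis : ([set w | V (S N w)] `\` h) `&` ([set w | V (S N w).+1] `&` h) = set0.
    by apply/seteqP; split => // w [[_ nh] [_ /nh]].
  rewrite (measureU _ mVD mV1 dis) measureD//; last by rewrite ltey_eq fin_num_measure.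
  rewrite fineD ?fin_numB ?fin_num_measure//.
  rewrite fineB ?fin_num_measure//.
  by rewrite hp (hp (fun j => V j.+1)).
rewrite -law fineK ?fin_num_measure//; last exact: (mS _ (fun j => U j.+1)).
congr (P _); apply/seteqP; split => w /=;
  by rewrite /containment_level containment_sum add1n.
Qed.

(** * Asymptotics of the choice probabilities *)

(** Both sides are [ln (1 + x) <= x], at [x = - 1 / (m + 1)] and at [x = 1 / m]. *)
Lemma ln_natS_bounds (R : realType) (m : nat) : (0 < m)%N ->
  m.+1%:R^-1 <= ln (m.+1%:R : R) - ln m%:R <= m%:R^-1.
Proof.
move=> m0; have M0 : 0 < m%:R :> R by rewrite ltr0n.
have M1 : 0 < m.+1%:R :> R by rewrite ltr0n.
rewrite -ln_div ?posrE//; apply/andP; split.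
  rewrite -[leRHS]opprK -lnV ?posrE ?divr_gt0// invf_div lerNr.
  have -> : m%:R / m.+1%:R = 1 + - m.+1%:R^-1 :> R.
    by rewrite -[m.+1%:R]natr1; field; rewrite natr1 gt_eqF.
  by apply: le_ln1Dx; rewrite ltrN2 invf_lt1// ltr1n.
rewrite -natr1 mulrDl divff ?gt_eqF// div1r; apply: le_ln1Dx.
by rewrite (lt_trans _ (_ : 0 < _))// ?invr_gt0// oppr_lt0.
Qed.

Lemma harmonic_bounds (R : realType) (a N : nat) : (0 < a)%N ->
  ln ((a + N).+1%:R : R) - ln a.+1%:R <= \sum_(i < N) (a + i).+1%:R^-1
    <= ln (a + N)%:R - ln (a%:R : R).
Proof.
move=> a0; elim: N => [|N IHN]; first by rewrite big_ord0 addn0 !subrr lexx.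
have /andP[l1 _] := ln_natS_bounds R (a + N) (ltn_addr _ a0).
have /andP[_ l2] := ln_natS_bounds R (a + N).+1 isT.
move: IHN; rewrite big_ord_recr/= addnS => /andP[h1 h2]; apply/andP; split.
  by apply: le_trans (lerD h1 l2); rewrite [leRHS]addrC addrA subrK.
by apply: (le_trans (lerD h2 l1)); rewrite [leLHS]addrC addrA subrK.
Qed.

(** Telescoping of [1 / (m + 1) ^ 2 <= 1 / m - 1 / (m + 1)], whose defect is exactly
    [1 / (m * (m + 1) ^ 2)]. *)
Lemma sum_inv_sqr_bound (R : realType) (a N : nat) : (0 < a)%N ->
  \sum_(i < N) (a + i).+1%:R^-1 ^+ 2 <= a%:R^-1 - (a + N)%:R^-1 :> R.
Proof.
move=> a0; elim: N => [|N IHN]; first by rewrite big_ord0 addn0 subrr.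
rewrite big_ord_recr/= addnS; apply: (le_trans (lerD IHN (lexx _))).
have M0 : 0 < (a + N)%:R :> R by rewrite ltr0n ltn_addr.
have M1 : 0 < (a + N).+1%:R :> R by rewrite ltr0n.
have E : (a + N)%:R^-1 - (a + N).+1%:R^-1 - (a + N).+1%:R^-1 ^+ 2 =
  (a + N)%:R^-1 * (a + N).+1%:R^-1 ^+ 2 :> R.
  rewrite -natr1 in M1 *; move: ((a + N)%:R) M0 M1 => u M0 M1.
  by field; rewrite !gt_eqF.
move: E; set x := (a + N)%:R^-1; set y := (a + N).+1%:R^-1 => E.
have : 0 <= x * y ^+ 2 by rewrite mulr_ge0 ?exprn_ge0 ?invr_ge0// ltW.
by rewrite -E; move: (a%:R^-1) => b; lra.
Qed.

Lemma choice_probability_harmonic (R : realType) (theta k i : nat) :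
  (2 <= theta)%N ->
  choice_probability R theta k i = (theta%:R - 1) * (k + theta.-1 + i).+1%:R^-1.
Proof.
move=> t2; rewrite (_ : (k + theta.-1 + i).+1 = (k + i + theta)%N)//.
by rewrite addnAC -addnS prednK// ltnW.
Qed.

Lemma sum_choice_probability_sqr (R : realType) (theta k N : nat) :
  (2 <= theta)%N ->
  \sum_(i < N) choice_probability R theta k i ^+ 2 <=
  (theta%:R - 1) ^+ 2 / (k + theta.-1)%:R.
Proof.
move=> t2; under eq_bigr do rewrite choice_probability_harmonic// exprMn.
rewrite -mulr_sumr ler_wpM2l ?sqr_ge0//.
have a0 : (0 < k + theta.-1)%N by rewrite ltn_addl// -subn1 subn_gt0.
apply: (le_trans (sum_inv_sqr_bound R _ N a0)).
by rewrite gerBl invr_ge0.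
Qed.

Lemma sum_choice_probability_bounds (R : realType) (theta k n : nat) :
  (2 <= theta)%N -> (k <= n)%N ->
  (theta%:R - 1) * (ln ((n + theta)%:R : R) - ln (k + theta)%:R) <=
    \sum_(i < n - k) choice_probability R theta k i <=
  (theta%:R - 1) * (ln (n + theta.-1)%:R - ln (k + theta.-1)%:R).
Proof.
move=> t2 kn; under eq_bigr do rewrite choice_probability_harmonic//.
have a0 : (0 < k + theta.-1)%N by rewrite ltn_addl// -subn1 subn_gt0.
have t1 : 0 <= theta%:R - 1 :> R by rewrite subr_ge0 ler1n ltnW.
have /andP[h1 h2] := harmonic_bounds R _ (n - k) a0.
have tE m : (m + theta.-1).+1 = (m + theta)%N by rewrite -addnS prednK// ltnW.
have nE : (k + theta.-1 + (n - k))%N = (n + theta.-1)%N by rewrite addnAC subnKC.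
rewrite nE !tE in h1 h2.
by rewrite -mulr_sumr; apply/andP; split; apply: ler_wpM2l.
Qed.

(** For [k <= n], adding [theta - 1] to both terms can only decrease the ratio [n / k]; in the other
    direction [ln (k + theta) <= ln k + theta / k]. The error is bounded for (ii) and vanishes as
    [k] grows, which (iii) and (iv) use. *)
Lemma sum_choice_probability_ln (R : realType) (theta k n : nat) :
  (2 <= theta)%N -> (0 < k <= n)%N ->
  `|\sum_(i < n - k) choice_probability R theta k i
    - (theta%:R - 1) * ln (n%:R / k%:R)| <= (theta%:R - 1) * theta%:R / k%:R.
Proof.
move=> t2 /andP[k0 kn].
have n0 : (0 < n)%N by exact: leq_trans kn.
have t1 : 0 <= theta%:R - 1 :> R by rewrite subr_ge0 ler1n ltnW.
have K0 : 0 < k%:R :> R by rewrite ltr0n.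
have N0 : 0 < n%:R :> R by rewrite ltr0n.
have /andP[h1 h2] := sum_choice_probability_bounds R theta k n t2 kn.
rewrite ln_div ?posrE//.
have u1 : ln (n + theta.-1)%:R - ln (k + theta.-1)%:R <= ln n%:R - ln k%:R :> R.
  rewrite -!ln_div ?posrE ?ltr0n ?addn_gt0 ?k0 ?n0//.
  rewrite ler_ln ?posrE ?divr_gt0 ?ltr0n ?addn_gt0 ?k0 ?n0//.
  rewrite ler_pdivrMr ?ltr0n ?addn_gt0 ?k0// mulrAC ler_pdivlMr//.
  by rewrite -!natrM ler_nat mulnDl mulnDr leq_add2l mulnC leq_mul.
have u2 : ln n%:R <= ln (n + theta)%:R :> R.
  by rewrite ler_ln ?posrE ?ltr0n ?addn_gt0 ?n0// ler_nat leq_addr.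
have u3 : ln (k + theta)%:R <= ln k%:R + theta%:R / k%:R :> R.
  rewrite -lerBlDl -ln_div ?posrE ?ltr0n ?addn_gt0 ?k0//.
  rewrite natrD mulrDl divff ?gt_eqF//; apply: le_ln1Dx.
  by rewrite (lt_le_trans _ (_ : 0 <= _))// ?divr_ge0// oppr_lt0.
rewrite ler_norml -mulrA; apply/andP; split.
  rewrite lerBrDl (le_trans _ h1)// -mulrN -mulrDr ler_wpM2l//; lra.
rewrite lerBlDl (le_trans h2)// -mulrDr ler_wpM2l//.
by rewrite (le_trans u1)// lerDl divr_ge0.
Qed.

(** Comparison with [ln n] instead of [ln (n / k)], so that [k = 0] is covered; the error does not
    depend on [n]. *)
Lemma sum_choice_probability_ln_fixed (R : realType) (theta k n : nat) :
  (2 <= theta)%N -> (k <= n)%N -> (0 < n)%N ->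
  `|\sum_(i < n - k) choice_probability R theta k i
    - (theta%:R - 1) * ln n%:R| <= (theta%:R - 1) * ln (k + theta)%:R.
Proof.
move=> t2 kn n0.
have t1 : 0 <= theta%:R - 1 :> R by rewrite subr_ge0 ler1n ltnW.
have N0 : 0 < n%:R :> R by rewrite ltr0n.
have T0 : (0 < theta)%N by exact: ltnW.
have T1 : (0 < theta.-1)%N by rewrite -subn1 subn_gt0.
have /andP[h1 h2] := sum_choice_probability_bounds R theta k n t2 kn.
(* This is [n + theta - 1 <= n * theta <= n * (k + theta)], valid for [n >= 1]. *)
have u1 : ln (n + theta.-1)%:R <= ln n%:R + ln (k + theta)%:R :> R.
  rewrite -lnM ?posrE ?ltr0n ?addn_gt0 ?T0 ?orbT//.
  rewrite ler_ln ?posrE ?mulr_gt0 ?ltr0n ?addn_gt0 ?n0 ?T0 ?orbT//.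
  rewrite -natrM ler_nat mulnDr (leq_trans _ (leq_addl _ _))//.
  rewrite -{2}(prednK T0) mulnS leq_add2l leq_pmull//.
have u2 : 0 <= ln (k + theta.-1)%:R :> R.
  by rewrite ln_ge0// ler1n addn_gt0 T1 orbT.
have u3 : ln n%:R <= ln (n + theta)%:R :> R.
  by rewrite ler_ln ?posrE ?ltr0n ?addn_gt0 ?n0// ler_nat leq_addr.
rewrite ler_norml; apply/andP; split.
  rewrite lerBrDl (le_trans _ h1)// -mulrBr ler_wpM2l//; lra.
rewrite lerBlDl (le_trans h2)// -mulrDr ler_wpM2l//; lra.
Qed.

(** * Convergence of the containment level *)

(** [Phi] is the distribution function [F] of the normal law of variance [tau], rescaled by
    [s = sqrt tau]: [F] has the normal density as derivative, and the rescaling turns its exponent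
    into [- y ^ 2 / 2]. *)
Lemma normal_cdf_gauss (R : realType) (tau : R) : 0 < tau ->
  exists c (Phi : R -> R), [/\ 0 <= c,
    forall y : R, is_derive y 1 Phi (c * expR (- (y ^+ 2 / 2))),
    Phi x @[x --> -oo] --> (0 : R), Phi x @[x --> +oo] --> (1 : R) &
    forall x, centered_normal tau [set` `]-oo, x]] = (Phi (x / Num.sqrt tau))%:E].
Proof.
move=> tau0; set s := Num.sqrt tau.
have s0 : 0 < s by rewrite sqrtr_gt0.
have sn0 : s != 0 by rewrite gt_eqF.
(* The identity, seen as a random variable under the normal law, makes the general limits of [cdf]
   at both infinities available. *)
pose X : {mfun measurableTypeR R >-> R} := HB.pack (idfun : measurableTypeR R -> R)
  (isMeasurableFun.Build _ _ _ _ (idfun : measurableTypeR R -> R)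
    (@measurable_id _ _ setT)).
have cdfE y : normal_prob 0 s [set` `]-oo, y]] = cdf (P := normal_prob 0 s) X y by [].
pose F y := fine (cdf (P := normal_prob 0 s) X y).
have FE y : cdf (P := normal_prob 0 s) X y = (F y)%:E by rewrite fineK// fin_num_measure.
have dF (y : R) : is_derive y 1 F (normal_pdf 0 s y).
  have int1 : lebesgue_measure.-integrable [set` `]-oo, y + 1]]
      (EFin \o normal_pdf 0 s).
    by apply: (integrableS measurableT) => //; exact: integrable_normal_pdf.
  have [|d1 d2] := continuous_FTC1 (_ : y < y + 1) int1 (ltNyr y)
    (@continuous_normal_pdf _ 0 s sn0 y); first by rewrite ltrDl.
  apply: DeriveDef; first exact: d1.
  by rewrite -derive1E; exact: d2.
exists (s * normal_peak s), (fun z => F (s * z)); split.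
- by rewrite mulr_ge0 ?normal_peak_ge0// ltW.
- move=> y.
  have ds : is_derive y 1 (fun z : R => s * z) s.
    by apply: is_derive_eq; rewrite /GRing.scale/=; ring.
  have ? := dF (s * y).
  have := is_derive1_comp (dF (s * y)) ds.
  rewrite normal_pdfE// /normal_fun subr0.
  rewrite (_ : - (s * y) ^+ 2 / (s ^+ 2 *+ 2) = - (y ^+ 2 / 2)); last first.
    by rewrite -mulr_natl; field.
  by rewrite mulrAC [_ * s]mulrC.
- have : F x @[x --> -oo] --> (0 : R) by apply: fine_cvg; exact: cvg_cdfNy0.
  apply: cvg_comp; apply: gt0_cvgMrNy => //; exact: cvg_id.
- have : F x @[x --> +oo] --> (1 : R) by apply: fine_cvg; exact: cvg_cdfy1.
  apply: cvg_comp; apply: gt0_cvgMry => //; exact: cvg_id.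
- by move=> x; rewrite mulrC divfK// -FE.
Qed.

Lemma cvg_near_EFin (R : realType) (f : nat -> \bar R) (u : nat -> R) (l : R) :
  (\forall n \near \oo, f n = (u n)%:E) -> u @ \oo --> l -> f @ \oo --> l%:E.
Proof.
move=> fu ul; apply: cvg_EFin; first by near=> n; rewrite (near fu n).
apply: cvg_trans ul; apply: near_eq_cvg; near=> n.
by rewrite /= (near fu n).
Unshelve. all: by end_near. Qed.

Lemma cdf_containment_level d (T : measurableType d) (R : realType)
    (P : probability T R) (theta : nat) (H : hyperrecursive_tree P theta)
    (r : 'I_theta) (n k : nat) (x : R) : (2 <= theta)%N -> (k <= n)%N ->
  cdf (natr_fun R (containment_level H r n k) : {RV P >-> R}) x =
  (bernoulli_mean (choice_probability R theta k) (n - k)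
    (fun j => (1 + j%:R <= x :> R)%R%:R))%:E.
Proof.
move=> t2 kn.
have -> : cdf (natr_fun R (containment_level H r n k) : {RV P >-> R}) x =
    P [set w | (containment_level H r n k w)%:R <= x].
  by congr (P _); apply/seteqP; split => w; rewrite /= in_itv.
rewrite (containment_level_law _ _ _ _ _ H r n k (fun j => j%:R <= x))//.
by congr EFin; apply: eq_bernoulli_mean => j; rewrite nat1r.
Qed.

Lemma cdf_normalized_containment_level d (T : measurableType d) (R : realType)
    (P : probability T R) (theta : nat) (H : hyperrecursive_tree P theta)
    (r : 'I_theta) (n k : nat) (a b x : R) : (2 <= theta)%N -> (k <= n)%N ->
  cdf (normalized (natr_fun R (containment_level H r n k)) a b : {RV P >-> R}) x =
  (bernoulli_mean (choice_probability R theta k) (n - k)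
    (fun j => ((1 + j%:R - a) / Num.sqrt b <= x)%R%:R))%:E.
Proof.
move=> t2 kn.
have -> : cdf (normalized (natr_fun R (containment_level H r n k)) a b
    : {RV P >-> R}) x =
    P [set w | ((containment_level H r n k w)%:R - a) / Num.sqrt b <= x].
  by congr (P _); apply/seteqP; split => w; rewrite /= in_itv.
rewrite (containment_level_law _ _ _ _ _ H r n k
  (fun j => (j%:R - a) / Num.sqrt b <= x))//.
by congr EFin; apply: eq_bernoulli_mean => j; rewrite nat1r.
Qed.

(** Common core of (i) and (ii), with [L = ln n] or [L = ln (n / k)]. The squares of the parameters
    sum to at most [(theta - 1) ^ 2] because [k + theta - 1 >= 1]. *)
Lemma containment_level_clt d (T : measurableType d) (R : realType)
    (P : probability T R) (theta : nat) (H : hyperrecursive_tree P theta)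
    (r : 'I_theta) (k : nat -> nat) (L : nat -> R) (K : R) : (2 <= theta)%N ->
  (\forall n \near \oo, (k n <= n)%N) ->
  L @ \oo --> +oo ->
  (\forall n \near \oo, `|\sum_(i < n - k n) choice_probability R theta (k n) i
    - (theta%:R - 1) * L n| <= K) ->
  cvg_in_distribution P (fun n => normalized
      (natr_fun R (containment_level H r n (k n))) ((theta%:R - 1) * L n) (L n))
    (centered_normal (theta%:R - 1)).
Proof.
move=> t2 kn Loo lK F x _; rewrite /F.
have tau0 : 0 < theta%:R - 1 :> R by rewrite subr_gt0 ltr1n.
have [c [Phi [c0 dPhi PhiN Phiy ->]]] := normal_cdf_gauss _ _ tau0.
apply: (@cvg_near_EFin _ _ (fun n => bernoulli_mean
    (choice_probability R theta (k n)) (n - k n)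
    (fun j => ((1 + j%:R - (theta%:R - 1) * L n) / Num.sqrt (L n) <= x)%R%:R))).
  by near=> n; apply: cdf_normalized_containment_level => //; near: n.
apply: (bernoulli_clt R Phi c (theta%:R - 1) (K + (theta%:R - 1) ^+ 2)) => //.
- by move=> n i; exact: choice_probability_itv.
- near=> n; rewrite ler_wpDr ?sqr_ge0//; near: n; exact: lK.
near=> n; apply: (le_trans (sum_choice_probability_sqr _ _ _ _ t2)).
have K0 : 0 <= K.
  apply: (@le_trans _ _ `|\sum_(i < n - k n) choice_probability R theta (k n) i
    - (theta%:R - 1) * L n|) => //.
  by near: n.
have a0 : (0 < k n + theta.-1)%N by rewrite ltn_addl// -subn1 subn_gt0.
by rewrite ler_wpDl// ler_pdivrMr ?ltr0n// ler_peMr ?sqr_ge0// ler1n.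
Unshelve. all: by end_near. Qed.

Lemma one_plus_poisson_itv (R : realType) (rho x : R) (J : nat) : 0 < rho ->
  (forall j, (1 + j%:R <= x) = (j < J)%N) ->
  one_plus_poisson rho [set` `]-oo, x]] = (poisson_sum rho J)%:E.
Proof.
move=> rho0 xJ.
have -> : one_plus_poisson rho [set` `]-oo, x]] = poisson_prob rho 0 `I_J.
  congr (poisson_prob rho 0 _).
  by apply/seteqP; split => j; rewrite /= in_itv/= xJ.
rewrite /poisson_prob rho0 esum_fset//; last first.
  by move=> j _; rewrite lee_fin poisson_pmf_ge0.
rewrite -fsbig_ord/= sumEFin; congr EFin; apply: eq_bigr => j _.
by rewrite /poisson_pmf rho0.
Qed.

Lemma natr_threshold (R : realType) (x : R) :
  exists J : nat, forall j : nat, (1 + j%:R <= x) = (j < J)%N.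
Proof.
have [x0|x0] := leP 0 x.
  (* For [x >= 0], [1 + j <= x] amounts to [j + 1] being at most the integer part of [x]. *)
  exists (Num.truncn x) => j.
  by rewrite nat1r -ltnS -[RHS]ltnS ltnS -truncn_ge_nat.
exists 0%N => j; apply/negbTE; rewrite -ltNge (lt_le_trans x0)// addr_ge0.
Qed.

Lemma continuous_poisson_sum (R : realType) (J : nat) :
  continuous (fun rho : R => poisson_sum rho J).
Proof.
move=> rho; apply/differentiable_continuous/derivable1_diffP.
by have [] := is_derive_poisson_sum R rho J.
Qed.

(** The value [alpha = 1] is included on purpose: the limit is then 0, which is what (iv) needs. The
    first limit comes from [1 / k = (n / k) * (1 / n)]. *)
Lemma sum_choice_probability_cvg (R : realType) (theta : nat) (k : nat -> nat)
    (alpha : R) : (2 <= theta)%N -> (forall n, (k n <= n)%N) -> 0 < alpha ->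
  (k n)%:R / n%:R @[n --> \oo] --> alpha ->
  ((k n)%:R^-1 : R) @[n --> \oo] --> (0 : R) /\
  \sum_(i < n - k n) choice_probability R theta (k n) i @[n --> \oo] -->
    (theta%:R - 1) * ln (1 / alpha).
Proof.
move=> t2 kn a0 ka.
have k0 : \forall n \near \oo, (0 < k n)%N.
  have : \forall n \near \oo, 0 < (k n)%:R / n%:R :> R by exact: (cvgr_gt _ ka).
  by apply: filterS => n; case: (k n) => //; rewrite mul0r ltxx.
have nk : n%:R / (k n)%:R @[n --> \oo] --> 1 / alpha.
  rewrite (_ : (fun _ => _) = (fun n => ((k n)%:R / n%:R)^-1)).
    by rewrite div1r; apply: cvgV => //; rewrite gt_eqF.
  by apply/funext => n; rewrite invf_div.
have n1 : (n%:R^-1 : R) @[n --> \oo] --> (0 : R).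
  apply/gtr0_cvgV0; last exact: cvgr_idn.
  by near=> n; rewrite ltr0n; near: n; exists 1%N.
have kV : ((k n)%:R^-1 : R) @[n --> \oo] --> (0 : R).
  rewrite -(mulr0 (1 / alpha)).
  apply: cvg_trans (cvgM nk n1); apply: near_eq_cvg; near=> n.
  have kn0 : (0 < k n)%N by near: n.
  have n0 : n%:R != 0 :> R by rewrite pnatr_eq0 -lt0n (leq_trans kn0).
  by rewrite /= mulrAC divff// mul1r.
split => //.
have lnk : ln (n%:R / (k n)%:R) @[n --> \oo] --> ln (1 / alpha).
  by apply: continuous_cvg nk; apply: continuous_ln; rewrite divr_gt0.
apply: (@cvg_close _ _ (fun n => (theta%:R - 1) * ln (n%:R / (k n)%:R))
  (fun n => (theta%:R - 1) * theta%:R * (k n)%:R^-1)).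
- near=> n; apply: sum_choice_probability_ln => //.
  by rewrite kn andbT; near: n.
- rewrite -(mulr0 ((theta%:R - 1) * theta%:R)).
  by apply: cvgM => //; exact: cvg_cst.
- by apply: cvgM => //; exact: cvg_cst.
Unshelve. all: by end_near. Qed.

Lemma containment_level_poisson d (T : measurableType d) (R : realType)
    (P : probability T R) (theta : nat) (H : hyperrecursive_tree P theta)
    (r : 'I_theta) (k : nat -> nat) (alpha : R) : (2 <= theta)%N ->
  (forall n, (k n <= n)%N) -> 0 < alpha < 1 ->
  (k n)%:R / n%:R @[n --> \oo] --> alpha ->
  cvg_in_distribution P (fun n => natr_fun R (containment_level H r n (k n)))
    (one_plus_poisson ((theta%:R - 1) * ln (1 / alpha))).
Proof.
move=> t2 kn /andP[a0 a1] ka F x _; rewrite /F.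
have [kV lamcvg] := sum_choice_probability_cvg R theta k alpha t2 kn a0 ka.
have [J xJ] := natr_threshold R x.
rewrite (@one_plus_poisson_itv _ _ _ J)//; last first.
  rewrite mulr_gt0 ?subr_gt0 ?ltr1n//.
  by rewrite ln_gt0// div1r invf_gt1.
apply: (@cvg_near_EFin _ _ (fun n => bernoulli_mean
    (choice_probability R theta (k n)) (n - k n) (fun j => (j < J)%N%:R))).
  apply: nearW => n; rewrite cdf_containment_level//; congr EFin.
  by apply: eq_bernoulli_mean => j; rewrite xJ.
apply: (@cvg_close _ _ (fun n => poisson_sum
    (\sum_(i < n - k n) choice_probability R theta (k n) i) J)
  (fun n => 2 * (theta%:R - 1) ^+ 2 * (k n)%:R^-1)).
- near=> n.
  have kn0 : (0 < k n)%N.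
    near: n.
    have : \forall n \near \oo, 0 < (k n)%:R / n%:R :> R by exact: (cvgr_gt _ ka).
    by apply: filterS => n; case: (k n) => //; rewrite mul0r ltxx.
  apply: le_trans (bernoulli_mean_poisson _ _ _ _ _) _.
    by move=> i; exact: choice_probability_itv.
  rewrite -mulrA ler_wpM2l//.
  apply: (le_trans (sum_choice_probability_sqr _ _ _ _ t2)).
  rewrite ler_wpM2l ?sqr_ge0// lef_pV2 ?posrE ?ltr0n ?addn_gt0 ?kn0//.
  by rewrite ler_nat leq_addr.
- rewrite -(mulr0 (2 * (theta%:R - 1) ^+ 2)).
  by apply: cvgM; [exact: cvg_cst|exact: kV].
- exact: (cvg_comp _ _ lamcvg (@continuous_poisson_sum R J _)).
Unshelve. all: by end_near. Qed.

Lemma containment_level_cvg1 d (T : measurableType d) (R : realType)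
    (P : probability T R) (theta : nat) (H : hyperrecursive_tree P theta)
    (r : 'I_theta) (k : nat -> nat) : (2 <= theta)%N ->
  (forall n, (k n <= n)%N) ->
  ((k n)%:R / n%:R : R) @[n --> \oo] --> (1 : R) ->
  cvg_in_probability P (fun n => natr_fun R (containment_level H r n (k n))) (cst 1).
Proof.
move=> t2 kn ka e e0.
have [_] := sum_choice_probability_cvg R theta k 1 t2 kn ltr01 ka.
rewrite divr1 ln1 mulr0 => lam0.
apply: (@cvg_near_EFin _ _ (fun n => bernoulli_mean
    (choice_probability R theta (k n)) (n - k n) (fun j => (e < j%:R)%R%:R))).
  apply: nearW => n.
  rewrite (containment_level_law _ _ _ _ _ H r n (k n)
    (fun j => e < `|j%:R - 1|))//.
  congr EFin; apply: eq_bernoulli_mean => j.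
  by rewrite -natr1 addrK ger0_norm.
apply: (@squeeze_cvgr _ _ _ _ (fun=> 0) (fun n => e^-1 *
  \sum_(i < n - k n) choice_probability R theta (k n) i)); last 2 first.
- exact: cvg_cst.
- by rewrite -[X in _ --> X](mulr0 e^-1); apply: cvgM; [exact: cvg_cst|exact: lam0].
apply: nearW => n.
have p01 i : 0 <= choice_probability R theta (k n) i <= 1.
  exact: choice_probability_itv.
apply/andP; split.
  rewrite -(bernoulli_mean_cst R (choice_probability R theta (k n)) (n - k n) 0).
  by apply: bernoulli_mean_le => // j; rewrite ler0n.
(* Markov's inequality: the indicator of [e < j] is at most [j / e]. *)
rewrite -bernoulli_mean_natr -[leRHS]addr0 -(mul0r (bernoulli_mean
  (choice_probability R theta (k n)) (n - k n) (fun=> 0))) -bernoulli_mean_lin.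
apply: bernoulli_mean_le => // j; rewrite mulr0 addr0.
have [ej|_] := ltP e j%:R; last by rewrite mulr_ge0// invr_ge0 ltW.
by rewrite mulrC ler_pdivlMr// mul1r ltW.
Qed.

Theorem theorem4p2 (R : realType) (d : measure_display) (T : measurableType d)
    (P : probability T R) (theta : nat) (theta_ge2 : (2 <= theta)%N)
    (H : hyperrecursive_tree P theta) (r : 'I_theta) :
  let C n k : {RV P >-> R} := natr_fun R (containment_level H r n k) in
  [/\ forall k : nat,
        cvg_in_distribution P
          (fun n => normalized (C n k) ((theta%:R - 1) * ln n%:R) (ln n%:R))
          (centered_normal (theta%:R - 1)),
      forall k : nat -> nat, (forall n, (k n <= n)%N) ->
        k n @[n --> \oo] --> \oo ->
        (fun n => (k n)%:R : R) =o_\oo (fun n => n%:R : R) ->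
        cvg_in_distribution P
          (fun n => normalized (C n (k n))
             ((theta%:R - 1) * ln (n%:R / (k n)%:R)) (ln (n%:R / (k n)%:R)))
          (centered_normal (theta%:R - 1)),
      forall (k : nat -> nat) (alpha : R), (forall n, (k n <= n)%N) ->
        0 < alpha < 1 ->
        (fun n => (k n)%:R : R) ~_\oo (fun n => alpha * n%:R : R) ->
        cvg_in_distribution P (fun n => C n (k n))
          (one_plus_poisson ((theta%:R - 1) * ln (1 / alpha)))
    & forall k : nat -> nat, (forall n, (k n <= n)%N) ->
        (fun n => n%:R - (k n)%:R : R) =o_\oo (fun n => n%:R : R) ->
        cvg_in_probability P (fun n => C n (k n)) (cst 1)].
Proof.
move=> C; split.
- move=> k; apply: (@containment_level_clt _ _ _ _ _ _ _ (fun=> k) (fun n => ln n%:R)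
    ((theta%:R - 1) * ln (k + theta)%:R)) => //.
  + by exists k.
  + apply/cvgryPge => A; near=> n.
    rewrite -ler_expR lnK ?posrE ?ltr0n; last by near: n; exists 1%N.
    by near: n; exact: nbhs_infty_ger.
  + near=> n; apply: sum_choice_probability_ln_fixed => //; near: n.
      by exists k.
    by exists 1%N.
- move=> k kn koo /eqoP ko.
  have k0 : \forall n \near \oo, (0 < k n)%N by exact: (proj1 (cvgnyPge _) koo 1%N).
  apply: (@containment_level_clt _ _ _ _ _ _ _ k (fun n => ln (n%:R / (k n)%:R))
    ((theta%:R - 1) * theta%:R)) => //.
  + by apply: nearW.
  + apply/cvgryPge => A.
    have eA : 0 < expR (- A) by exact: expR_gt0.
    (* Eventually [k n <= exp (- A) * n], which is [ln (n / k n) >= A]. *)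
    near=> n.
    have kn0 : (0 < k n)%N by near: n.
    have n0 : (0 < n)%N by exact: leq_trans (kn n).
    rewrite -ler_expR lnK ?posrE ?divr_gt0 ?ltr0n// ler_pdivlMr ?ltr0n//.
    rewrite -ler_pdivlMl ?expR_gt0// -expRN.
    have : `|(k n)%:R| <= expR (- A) * `|n%:R| :> R by near: n; exact: ko.
    by rewrite !normr_nat.
  + near=> n.
    have kn0 : (0 < k n)%N by near: n.
    apply: le_trans (sum_choice_probability_ln R theta (k n) n theta_ge2 _) _.
      by rewrite kn0 kn.
    rewrite ler_pdivrMr ?ltr0n// ler_peMr ?ler1n// mulr_ge0//.
    by rewrite subr_ge0 ler1n ltnW.
- move=> k alpha kn a01 /eqaddoP ka.
  apply: containment_level_poisson => //.
  have /andP[a0 _] := a01.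
  apply/cvgrPdist_le => e e0; near=> n.
  have n0 : (0 < n)%N by near: n; exists 1%N.
  have n0' : 0 < n%:R :> R by rewrite ltr0n.
  (* The equivalence bounds the gap relative to [alpha * n]; the tolerance [e / alpha] makes it at
     most [e * n]. *)
  have : `|(k n)%:R - alpha * n%:R| <= e / alpha * `|alpha * n%:R|.
    by near: n; apply: ka; rewrite divr_gt0.
  rewrite distrC => close.
  have -> : alpha - (k n)%:R / n%:R = (alpha * n%:R - (k n)%:R) / n%:R.
    by rewrite mulrBl mulfK// gt_eqF.
  rewrite normrM normfV normr_nat ler_pdivrMr// (le_trans close)//.
  by rewrite normrM normr_nat gtr0_norm// mulrA divfK// gt_eqF.
- move=> k kn /eqoP ko; apply: containment_level_cvg1 => //.
  apply/cvgrPdist_le => e e0; near=> n.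
  have n0 : (0 < n)%N by near: n; exists 1%N.
  have n0' : 0 < n%:R :> R by rewrite ltr0n.
  have close : `|n%:R - (k n)%:R| <= e * `|n%:R| :> R by near: n; exact: ko.
  have -> : 1 - (k n)%:R / n%:R = (n%:R - (k n)%:R) / n%:R :> R.
    by rewrite mulrBl divff// gt_eqF.
  by rewrite normrM normfV normr_nat ler_pdivrMr// -[X in _ * X]normr_nat.
Unshelve. all: by end_near. Qed.
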